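(* Let $\mathbb{Y}=\{a,b\}$ be a two-letter alphabet and $\lambda$ a partition. Then \[ \sum_{\substack{\mu\\ \mu\text{ even}}} Q'_{\lambda/\mu}[-\mathbb{Y};t]=(-a)^{l(\lambda_{\mathrm{o}})}\,h_{\lambda_{\mathrm{e}}}(ab;t)\,h_{\lambda_{\mathrm{o}}}(b/a;t), \] where the sum is over all partitions $\mu$ all of whose parts are even.
   Context: For partitions, $f^{\lambda}_{\mu\nu}(t)$ are the Hall–Littlewood structure constants, $P_\mu P_\nu=\sum_\lambda f^\lambda_{\mu\nu}(t)P_\lambda$, where $P_\lambda(\cdot;t)$ is the Hall–Littlewood function; $Q_\lambda=b_\lambda(t)P_\lambda$ with $b_\lambda(t)=\prod_{i\ge1}(t;t)_{m_i(\lambda)}$, and the skew function is $Q_{\lambda/\mu}=\sum_\nu f^\lambda_{\mu\nu}(t)Q_\nu$. Plethystic notation: for a symmetric function $F$, $F[-\mathbb{Y}/(1-t)]$ is the specialization sending the power sum $p_r$ to $-(a^r+b^r)/(1-t^r)$, and $Q'_{\lambda/\mu}[-\mathbb{Y};t]:=Q_{\lambda/\mu}[-\mathbb{Y}/(1-t);t]$. $m_i(\lambda)$ is the multiplicity of part $i$, $l(\lambda)$ the number of parts, $\lambda_{\mathrm{e}}$, $\lambda_{\mathrm{o}}$ the partitions of even, resp. odd, parts of $\lambda$. Rogers–Szegő: $H_m(z;t)=\sum_{i=0}^m z^i\binom{m}{i}_t$, $\binom{m}{i}_t=\frac{(t;t)_m}{(t;t)_i(t;t)_{m-i}}$, $(t;t)_n=\prod_{k=1}^n(1-t^k)$,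 $h_\lambda(z;t)=\prod_{i\ge1}H_{m_i(\lambda)}(z;t)$. *)

(* Defs.v *)
From HB Require Import structures.
From mathcomp Require Import all_boot all_order all_algebra all_fingroup finmap.
From mathcomp Require Import boolp classical_sets fsbigop.
From mathcomp Require Import monalg mpoly.

Set Implicit Arguments.
Unset Strict Implicit.
Unset Printing Implicit Defensive.

Import GRing.Theory.
Local Open Scope ring_scope.

(** * Partitions *)

(* Nonincreasing sequences of positive integers; the weight is [sumn la], the
   length is [size la], and [nth 0 la i] is the part of index [i], counted from
   0 and equal to 0 beyond the length. *)
Record intpart := IntPart {
  parts :> seq nat;
  partsP : sorted geq parts && all (leq 1) parts }.

HB.instance Definition _ := [isSub for parts].
HB.instance Definition _ := [Countable of intpart by <:].

Definition mult (la : intpart) (i : nat) : nat := count_mem i la.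

Fact filter_parts_subproof (p : pred nat) (la : intpart) :
  sorted geq (filter p la) && all (leq 1) (filter p la).
Proof.
have /andP[srt pos] := partsP la; apply/andP; split.
  by apply: sorted_filter srt => x y z yx zx; exact: leq_trans zx yx.
by rewrite all_filter; apply: sub_all pos => i i_gt0; apply/implyP.
Qed.

Definition filter_parts (p : pred nat) (la : intpart) : intpart :=
  IntPart (filter_parts_subproof p la).

Definition even_parts := filter_parts (fun i => ~~ odd i).
Definition odd_parts := filter_parts odd.

Definition even_partition (mu : intpart) : bool := all (fun i => ~~ odd i) mu.

(** * Rogers-Szego polynomials *)

Section RogersSzego.
Variables (K : fieldType) (t : K).

(* The t-shifted factorial (t;t)_n *)
Definition tfact (n : nat) : K := \prod_(1 <= k < n.+1) (1 - t ^+ k).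

Definition tbinom (m i : nat) : K := tfact m / (tfact i * tfact (m - i)).

Definition rogers_szego (m : nat) (z : K) : K :=
  \sum_(0 <= i < m.+1) z ^+ i * tbinom m i.

(* The product over all i >= 1 is truncated at the largest part: the remaining
   factors are [rogers_szego 0 z = 1]; similarly for [hl_b] below. *)
Definition rs_h (la : intpart) (z : K) : K :=
  \prod_(1 <= i < (head 0%N la).+1) rogers_szego (mult la i) z.

End RogersSzego.

(** * Symmetric functions *)

(* In characteristic 0 the ring of symmetric functions is the polynomial ring
   in the power sums p_1, p_2, ...  The variable of index [i : nat] stands for
   p_(i+1). *)
Definition symfun (K : fieldType) := {malg K[{cmonom nat}]}.

Section SymFun.
Variable K : fieldType.

(* The homomorphism that is [f] on scalars and sends p_r to [v r], r >= 1 *)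
Definition psum_spec (S : comNzRingType) (f : K -> S) (v : nat -> S) :
    symfun K -> S :=
  monalg.mmap f (fun m : {cmonom nat} => \prod_(i <- finsupp m) v i.+1 ^+ m i).

(* Rational functions in x_0, ..., x_(n-1) *)
Definition ratfun (n : nat) := {fraction mpoly n K}.

Definition rf_const n (c : K) : ratfun n := FracField.tofrac (mpolyC n c).
Definition rf_var n (i : 'I_n) : ratfun n := FracField.tofrac ('X_i : mpoly n K).

(* F(x_0, ..., x_(n-1)) *)
Definition in_vars n : symfun K -> ratfun n :=
  psum_spec (@rf_const n) (fun r => \sum_(i < n) rf_var i ^+ r).

End SymFun.

(** * Hall-Littlewood functions *)

Section HallLittlewood.
Variables (K : fieldType) (t : K).
Implicit Types la mu nu : intpart.

(* v_m(t) = prod_(1 <= k <= m) (1 - t^k) / (1 - t) *)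
Definition hl_v1 (m : nat) : K := \prod_(1 <= k < m.+1) ((1 - t ^+ k) / (1 - t)).

(* v_la(t), the product of the v_(m_i)(t) over i >= 0, where the multiplicity
   of i is that in the sequence obtained by padding [la] with zeros to length n,
   so that m_0 = n - l(la) *)
Definition hl_v (n : nat) la : K :=
  \prod_(0 <= i < (head 0%N la).+1) hl_v1 #|[pred j : 'I_n | nth 0%N la j == i]|.

(* P_la(x_0, ..., x_(n-1); t) for l(la) <= n: v_la(t)^-1 times the sum over
   w in S_n of w(x^la prod_(i < j) (x_i - t x_j) / (x_i - x_j)) *)
Definition hl_P_vars (n : nat) la : ratfun K n :=
  let x := @rf_var K n in
  rf_const n (hl_v n la)^-1 *
  \sum_(w : 'S_n)
    ((\prod_(i < n) x (w i) ^+ nth 0%N la i) *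
     \prod_(i < n) \prod_(j < n | (i < j)%N)
        ((x (w i) - rf_const n t * x (w j)) / (x (w i) - x (w j)))).

(* P_la(.; t): the symmetric function with these specializations, which exists
   and is unique when K has characteristic 0 and t is not a root of unity; under
   the same hypotheses (P_la) is a basis, so that the expansion below also
   exists and is unique *)
Definition hl_P la : symfun K :=
  xget 0 [set F : symfun K |
    forall n : nat, (size la <= n)%N -> in_vars n F = hl_P_vars n la]%classic.

(* The expansion of P_mu P_nu in the basis (P_la), as a finitely supported
   family of coefficients *)
Definition hl_expansion mu nu : {malg K[intpart]} :=
  xget 0 [set c : {malg K[intpart]} |
    hl_P mu * hl_P nu = \sum_(la <- monalg.msupp c) monalg.mcoeff la c *: hl_P la]%classic.

(* The structure constant f^la_(mu nu)(t) *)
Definition hl_f la mu nu : K := monalg.mcoeff la (hl_expansion mu nu).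

Definition hl_b la : K :=
  \prod_(1 <= i < (head 0%N la).+1) tfact t (mult la i).

Definition hl_Q la : symfun K := hl_b la *: hl_P la.

Definition hl_Qskew la mu : symfun K :=
  \sum_(nu \in [set: intpart]%classic) hl_f la mu nu *: hl_Q nu.

(* F[-Y/(1-t)] for the two-letter alphabet Y = {a, b} *)
Definition pleth_neg (a b : K) : symfun K -> K :=
  psum_spec idfun (fun r => - (a ^+ r + b ^+ r) / (1 - t ^+ r)).

(* Q'_(la/mu)[-Y; t] *)
Definition hl_Q'skew (a b : K) la mu : K := pleth_neg a b (hl_Qskew la mu).

End HallLittlewood.

(* Main.v *)
From HB Require Import structures.
Require Import Defs.
From mathcomp Require Import all_boot all_algebra boolp classical_sets fsbigop.
From mathcomp Require Import all_fingroup finmap monalg mpoly ring zify.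
Import GRing.Theory.
Local Open Scope ring_scope.

Set Implicit Arguments.
Unset Strict Implicit.
Unset Printing Implicit Defensive.

(* Partitions are handled through their conjugates c = la', d = mu'.  In n
   variables, the symmetrized sums R(al), al a composition, satisfy
   R(.., s, s+1, ..) = t R(.., s+1, s, ..).  Multiplying R(mu) by
   prod_i (1 + z x_i) adds 0 or 1 to each part of mu, and straightening the
   result gives the Pieri rule
     e_r P_mu = sum_la prod_i [c_i - c_(i+1) choose c_i - d_i]_t P_la
   over the vertical strips la/mu of size r.  In it e_(c_1) P_(c_2, c_3, ...)
   equals P_c plus terms P_k with k_1 > c_1; by induction this yields the
   P_la as symmetric functions, shows that they span, hence by counting that
   they form a basis, and determines F |-> F[-Y/(1-t)] on them: the value at
   P_la vanishes if la has a part larger than 2 and is otherwise, up to simple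
   factors, a Rogers-Szego polynomial, by the linearization formula for these.
   Consequently sum_nu Q_nu[-Y/(1-t)] P_nu = sum_(r,s) (-b)^r (-a)^s e_r e_s,
   and Q'_(la/mu)[-Y] is a sum over nu of pairs of vertical strips la/nu,
   nu/mu.  If mu is even it is determined by nu, and the sum over nu is a
   product over the columns of la. *)

(** * Gaussian binomials and straightening *)

Section GaussianBinomials.
Variables (K : fieldType) (t : K).

Definition gbin (m k : nat) : K := if (k <= m)%N then tbinom t m k else 0.

Lemma tfact0 : tfact t 0 = 1.
Proof. by rewrite /tfact big_geq. Qed.

Lemma tfactS n : tfact t n.+1 = tfact t n * (1 - t ^+ n.+1).
Proof. by rewrite /tfact big_nat_recr. Qed.

Hypothesis t_generic : forall r : nat, (0 < r)%N -> t ^+ r != 1.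

Lemma t_generic_sub r : 1 - t ^+ r.+1 != 0.
Proof. by rewrite subr_eq0 eq_sym t_generic. Qed.

Lemma tfact_neq0 n : tfact t n != 0.
Proof.
elim: n => [|n IHn]; first by rewrite tfact0 oner_neq0.
by rewrite tfactS mulf_neq0 ?t_generic_sub.
Qed.

Lemma gbin0 m : gbin m 0 = 1.
Proof. by rewrite /gbin /tbinom tfact0 mul1r subn0 divff ?tfact_neq0. Qed.

Lemma gbinn m : gbin m m = 1.
Proof. by rewrite /gbin leqnn /tbinom subnn tfact0 mulr1 divff ?tfact_neq0. Qed.

Lemma gbin_small m k : (m < k)%N -> gbin m k = 0.
Proof. by move=> ltmk; rewrite /gbin leqNgt ltmk. Qed.

Lemma gbinE m k : (k <= m)%N -> gbin m k = tfact t m / (tfact t k * tfact t (m - k)).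
Proof. by rewrite /gbin => ->. Qed.

Lemma gbinS m k : gbin m.+1 k.+1 = gbin m k + t ^+ k.+1 * gbin m k.+1.
Proof.
have [ltkm|ltmk|->] := ltngtP k m; last 2 first.
- by rewrite !gbin_small ?mulr0 ?addr0 // ltnW.
- by rewrite !gbinn gbin_small // mulr0 addr0.
have lekm := ltnW ltkm; rewrite !gbinE // subSS -(subnSK ltkm) !tfactS.
have -> : t ^+ m.+1 = t ^+ k.+1 * t ^+ (m - k.+1).+1.
  by rewrite -exprD; congr (_ ^+ _); lia.
by field; rewrite !tfact_neq0 !t_generic_sub.
Qed.

Lemma gbin_sym m k : (k <= m)%N -> gbin m (m - k) = gbin m k.
Proof. by move=> lekm; rewrite !gbinE ?leq_subr // subKn // [X in _ / X]mulrC. Qed.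

End GaussianBinomials.

Section RaisedWords.
Variables (S : comNzRingType) (z t : S).

Fixpoint incsum (G : seq nat -> S) (s : seq nat) : S :=
  if s is a :: s' then
    incsum (fun u => G (a :: u)) s' + z * incsum (fun u => G (a.+1 :: u)) s'
  else G [::].

Lemma eq_incsum G1 G2 s : G1 =1 G2 -> incsum G1 s = incsum G2 s.
Proof.
elim: s G1 G2 => [|a s IHs] G1 G2 eqG //=.
by congr (_ + _ * _); apply: IHs => u; rewrite eqG.
Qed.

Lemma incsum_cat G s1 s2 :
  incsum G (s1 ++ s2) = incsum (fun u => incsum (fun v => G (u ++ v)) s2) s1.
Proof. by elim: s1 G => [|a s1 IHs] G //=; rewrite !IHs. Qed.

Lemma incsum_map_succ G s :
  incsum G (map succn s) = incsum (fun u => G (map succn u)) s.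
Proof. by elim: s G => [|a s IHs] G //=; rewrite !IHs. Qed.

Lemma incsum_sum (I : Type) (r : seq I) (c : I -> S) (G : I -> seq nat -> S) s :
  incsum (fun u => \sum_(i <- r) c i * G i u) s = \sum_(i <- r) c i * incsum (G i) s.
Proof.
elim: s G => [|a s IHs] G //=; rewrite !IHs mulr_sumr -big_split /=.
by apply: eq_bigr => i _; ring.
Qed.

Lemma incsum_size G1 G2 s :
  (forall u, size u = size s -> G1 u = G2 u) -> incsum G1 s = incsum G2 s.
Proof.
elim: s G1 G2 => [|a s IHs] G1 G2 eqG /=; first exact: eqG.
by congr (_ + _ * _); apply: IHs => u su; apply: eqG; rewrite /= su.
Qed.

Definition straightens (G : seq nat -> S) :=
  forall u v a, G (u ++ [:: a, a.+1 & v]) = t * G (u ++ [:: a.+1, a & v]).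

Lemma straightens_cons G a : straightens G -> straightens (fun u => G (a :: u)).
Proof. by move=> sG u v b; exact: (sG (a :: u)). Qed.

Lemma straightens_map_succ G s :
  straightens G -> straightens (fun u => G (map succn u ++ s)).
Proof. by move=> sG u v b; rewrite !map_cat /= -!catA; exact: sG. Qed.

Lemma straighten_nseq G a k v : straightens G ->
  G (a :: nseq k a.+1 ++ v) = t ^+ k * G (nseq k a.+1 ++ a :: v).
Proof.
move=> sG; elim: k G sG => [|k IHk] G sG /=; first by rewrite mul1r.
rewrite (sG [::]) /= exprS -mulrA; congr (_ * _).
exact: (IHk (fun u => G (a.+1 :: u)) (straightens_cons _ sG)).
Qed.

Variable bn : nat -> nat -> S.
Hypothesis bn0 : forall m, bn m 0 = 1.
Hypothesis bn_small : forall m k, (m < k)%N -> bn m k = 0.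
Hypothesis bnS : forall m k, bn m.+1 k.+1 = bn m k + t ^+ k.+1 * bn m k.+1.

Lemma incsum_nseq G m a : straightens G ->
  incsum G (nseq m a) =
    \sum_(0 <= k < m.+1) bn m k * z ^+ k * G (nseq k a.+1 ++ nseq (m - k) a).
Proof.
move=> sG; elim: m G sG => [|m IHm] G sG.
  by rewrite big_nat1 /= bn0 !mul1r.
rewrite /= !IHm; try exact: straightens_cons.
rewrite [RHS]big_nat_recl // bn0 mulr1 mul1r subn0 /=.
rewrite (eq_bigr (fun k => t ^+ k * bn m k * z ^+ k *
          G (nseq k a.+1 ++ nseq (m.+1 - k) a))); last first.
  move=> k _; rewrite straighten_nseq //; have [lemk|ltmk] := leqP k m.
    by rewrite subSn //=; ring.
  by rewrite bn_small // !(mul0r, mulr0).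
rewrite mulr_sumr big_nat_recl // -addrA.
congr (_ + _); first by rewrite bn0 !mulr1 mul1r subn0.
rewrite [X in _ = X](eq_bigr (fun k => t ^+ k.+1 * bn m k.+1 * z ^+ k.+1 *
     G (nseq k.+1 a.+1 ++ nseq (m.+1 - k.+1) a) + 
   z * (bn m k * z ^+ k * G (a.+1 :: nseq k a.+1 ++ nseq (m - k) a)))); last first.
  move=> k _; rewrite bnS subSS /= !exprS. ring.
rewrite big_split /= [X in _ = X + _]big_nat_recr //= bn_small //.
by rewrite mulr0 !mul0r addr0.
Qed.

(* The conjugate of [d], padded with zeros to length [n]. *)
Definition conj_word (n : nat) (d : seq nat) : seq nat :=
  mkseq (fun i => count (fun v => i < v)%N d) n.

Lemma size_conj_word n d : size (conj_word n d) = n.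
Proof. by rewrite size_mkseq. Qed.

Lemma conj_word_nil n : conj_word n [::] = nseq n 0%N.
Proof.
by apply: (@eq_from_nth _ 0%N) => [|i]; rewrite size_conj_word ?size_nseq // => ltin;
  rewrite nth_mkseq // nth_nseq ltin.
Qed.

Lemma sorted_geq_head d1 d : sorted geq (d1 :: d) -> all (geq d1) d.
Proof. by apply: order_path_min => y x w xy wx; exact: leq_trans wx xy. Qed.

Lemma conj_word_cons n d1 d : sorted geq (d1 :: d) -> (d1 <= n)%N ->
  conj_word n (d1 :: d) = map succn (conj_word d1 d) ++ nseq (n - d1) 0%N.
Proof.
move=> srt led1; apply: (@eq_from_nth _ 0%N).
  by rewrite size_cat size_map !size_conj_word size_nseq; lia.
move=> i; rewrite size_conj_word => ltin; rewrite nth_mkseq //= nth_cat size_map.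
rewrite size_conj_word; case: ltnP => ltid1.
  by rewrite (nth_map 0%N) ?size_conj_word // nth_mkseq.
rewrite nth_nseq if_same add0n; apply/eqP; rewrite -leqn0 leqNgt -has_count.
apply/hasPn => v /(allP (sorted_geq_head srt)) /= ledv.
by rewrite -leqNgt (leq_trans ledv).
Qed.

Lemma conj_word_widen n m d : (head 0%N d <= m)%N -> (m <= n)%N -> sorted geq d ->
  conj_word n d = conj_word m d ++ nseq (n - m) 0%N.
Proof.
move=> ledm lemn srt; apply: (@eq_from_nth _ 0%N).
  by rewrite size_cat !size_conj_word size_nseq; lia.
move=> i; rewrite size_conj_word => ltin; rewrite nth_mkseq //= nth_cat.
rewrite size_conj_word; case: ltnP => ltid1; first by rewrite nth_mkseq.
rewrite nth_nseq if_same; apply/eqP; rewrite -leqn0 leqNgt -has_count.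
apply/hasPn => v; rewrite -leqNgt => vd; apply: leq_trans (leq_trans ledm ltid1).
case: d srt vd {ledm} => //= x d srt; rewrite inE => /orP[/eqP-> //|].
by move/(allP (sorted_geq_head srt)).
Qed.

(* The sequences c with n >= c_1 >= d_1 >= c_2 >= d_2 >= ...; if c and d are
   conjugate to la and mu, this says that la/mu is a vertical strip. *)
Fixpoint interlacing (n : nat) (d : seq nat) : seq (seq nat) :=
  if d is d1 :: d' then
    [seq c1 :: c | c1 <- index_iota d1 n.+1, c <- interlacing d1 d']
  else [seq [:: c1] | c1 <- index_iota 0 n.+1].

Fixpoint up_weight (n : nat) (c d : seq nat) : S :=
  match c, d with
  | c1 :: c', d1 :: d' => bn (n - d1) (c1 - d1) * up_weight d1 c' d'
  | c1 :: _, [::] => bn n c1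
  | [::], _ => 0
  end.

Lemma interlacingP n d c : c \in interlacing n d ->
  [/\ size c = (size d).+1, (head 0 c <= n)%N, (head 0 d <= head 0 c)%N,
      (sumn d <= sumn c)%N & sorted geq c].
Proof.
elim: d n c => [|d1 d IHd] n c.
  by case/mapP => c1; rewrite mem_index_iota => /andP[_ ltc1] -> /=; split.
move=> /=; case/allpairsPdep => [c1 [c' [c1P /IHd[sc' lec' _ sumc' srt] ->]]] /=.
move: c1P; rewrite mem_index_iota => /andP[led1 lec1].
split => //; rewrite ?sc' ?leq_add //.
by case: c' sc' lec' srt {sumc'} => //= c2 c' _ lec2 ->; rewrite andbT (leq_trans lec2).
Qed.

Lemma incsum_conj_word G n d : sorted geq d -> (head 0%N d <= n)%N -> straightens G ->
  incsum G (conj_word n d) =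
    \sum_(c <- interlacing n d)
       up_weight n c d * z ^+ (sumn c - sumn d) * G (conj_word n c).
Proof.
elim: d n G => [|d1 d IHd] n G srt led sG.
  rewrite conj_word_nil incsum_nseq // big_map; apply: eq_big_nat => k /andP[_ lekn].
  by rewrite /= addn0 subn0 conj_word_cons //= conj_word_nil map_nseq.
rewrite /= in led; have srt' := path_sorted srt.
have led' : (head 0%N d <= d1)%N.
  by move: srt {IHd}; rewrite {1}[sorted _ _]/=; case: (d) => [|a d'] /=; [|case/andP].
rewrite conj_word_cons // incsum_cat incsum_map_succ.
have sGu u : straightens (fun v => G (map succn u ++ v)).
  by move=> u' v' b; rewrite !catA; exact: sG.
rewrite (eq_incsum _ (fun u => incsum_nseq _ _ (sGu u))) incsum_sum.
rewrite big_allpairs_dep /= -[index_iota d1 _]/(index_iota (0 + d1) n.+1) big_addn.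
rewrite subSn //.
apply: eq_big_nat => k; rewrite ltnS => /andP[_ lek].
set H := fun u : seq nat => _.
have sH : straightens H.
  by rewrite /H => u v b; apply: (straightens_map_succ _ sG).
rewrite IHd //.
rewrite mulr_sumr; apply: eq_big_seq => c /interlacingP[sc lec _ sumc srtc].
rewrite /H [X in _ = _ * G X](@conj_word_cons n (k + d1)) //; last 2 first.
- case: c sc lec srtc {sumc} => //= c1 c' _ lec ->; rewrite andbT.
  by rewrite (leq_trans lec) // leq_addl.
- by lia.
rewrite (@conj_word_widen (k + d1) d1) ?leq_addl // map_cat map_nseq addnK -catA.
rewrite /= (_ : k + d1 + sumn c - (d1 + sumn d) = k + (sumn c - sumn d))%N; last by lia.
rewrite exprD (_ : n - (k + d1) = n - d1 - k)%N; last by lia.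
by ring.
Qed.

End RaisedWords.

(** * Symmetrized sums in n variables *)

Section Lagrange.
Variable F : fieldType.

Lemma lagrange_lead (m : nat) (y : 'I_m.+1 -> F) (p : {poly F}) :
  injective y -> (size p <= m.+1)%N ->
  \sum_i p.[y i] / \prod_(j | j != i) (y i - y j) = p`_m.
Proof.
move=> injy szp.
pose l i := \prod_(j | j != i) ('X - (y j)%:P).
pose q := \sum_i (p.[y i] / \prod_(j | j != i) (y i - y j)) *: l i.
have dn0 i : \prod_(j | j != i) (y i - y j) != 0.
  by rewrite prodf_seq_neq0; apply/allP => j _; apply/implyP => nji;
     rewrite subr_eq0 (inj_eq injy) eq_sym.
have hl i k : (l i).[y k] = (i == k)%:R * \prod_(j | j != i) (y i - y j).
  rewrite horner_prod; case: eqVneq => [->|nik].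
    by rewrite mul1r; apply: eq_bigr => j _; rewrite !hornerE.
  by rewrite mul0r (bigD1 k) 1?eq_sym //= !hornerE subrr mul0r.
have szl i : size (l i) = m.+1.
  rewrite /l -big_filter size_prod_XsubC -sum1_size big_filter sum1_card.
  by rewrite cardC1 card_ord.
have monl i : (l i)`_m = 1.
  have /monicP : l i \is monic by apply: monic_prod_XsubC.
  by rewrite lead_coefE szl.
have pq : p = q.
  apply/eqP; rewrite -subr_eq0; apply/eqP.
  apply: (@roots_geq_poly_eq0 _ _ [seq y i | i <- enum 'I_m.+1]).
  - apply/allP => _ /mapP[k _ ->]; apply/rootP; rewrite hornerD hornerN horner_sum.
    rewrite (bigD1 k) //= [X in _ - (_ + X)]big1 => [|i nik]; last first.
      by rewrite hornerZ hl (negPf nik) mul0r mulr0.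
    by rewrite hornerZ hl eqxx mul1r divfK // addr0 subrr.
  - by rewrite map_inj_uniq // enum_uniq.
  - rewrite size_map size_enum_ord; apply: leq_trans (size_polyD _ _) _.
    rewrite geq_max szp size_polyN; apply: leq_trans (size_sum _ _ _) _.
    by apply/bigmax_leqP => i _; apply: leq_trans (size_scale_leq _ _) _; rewrite szl.
rewrite {2}pq coef_sum; apply: eq_bigr => i _.
by rewrite coefZ monl mulr1.
Qed.

(* Interpolation of prod_j (X - t x_j) at the nodes 0, x_1, ..., x_n. *)
Lemma sum_hl_ratio (t : F) (n : nat) (x : 'I_n -> F) :
  injective x -> (forall i, x i != 0) ->
  (1 - t) * (\sum_k \prod_(j | j != k) ((x k - t * x j) / (x k - x j))) = 1 - t ^+ n.
Proof.
move=> injx xn0.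
pose y (i : 'I_n.+1) := if unlift ord0 i is Some j then x j else 0.
have y0 : y ord0 = 0 by rewrite /y unlift_none.
have yl j : y (lift ord0 j) = x j by rewrite /y liftK.
have injy : injective y.
  move=> i j; rewrite /y; case: unliftP => [i' ->|->]; case: unliftP => [j' ->|->] //.
  - by move/injx ->.
  - by move/eqP; rewrite (negPf (xn0 _)).
  - by move/esym/eqP; rewrite (negPf (xn0 _)).
pose p := \prod_j ('X - (t * x j)%:P).
have szp : size p = n.+1 by rewrite size_prod_XsubC -[index_enum _]enumT size_enum_ord.
have := @lagrange_lead n y p injy; rewrite szp leqnn => /(_ isT).
have -> : p`_n = 1.
  have /monicP : p \is monic by apply: monic_prod_XsubC.
  by rewrite lead_coefE szp.
have den0 : \prod_(j | j != ord0) (y ord0 - y j) = \prod_j - x j.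
  rewrite big_mkcond big_ord_recl eqxx /= mul1r; apply: eq_bigr => j _.
  by rewrite /= y0 yl sub0r.
have denl k : \prod_(j | j != lift ord0 k) (y (lift ord0 k) - y j) =
    x k * \prod_(j | j != k) (x k - x j).
  rewrite big_mkcond big_ord_recl neq_lift /= y0 yl subr0; congr (_ * _).
  rewrite [RHS]big_mkcond; apply: eq_bigr => j _.
  by rewrite (inj_eq lift_inj) yl.
have e0 : p.[0] / \prod_j - x j = t ^+ n.
  rewrite horner_prod -prodf_div -[RHS](_ : \prod_(j < n) t = _).
    by apply: eq_bigr => j _; rewrite !hornerE ?sub0r ?add0r -mulrN mulfK // oppr_eq0.
  by rewrite prodr_const card_ord.
rewrite big_ord_recl den0 y0 e0 => h; apply: (addrI (t ^+ n)).
rewrite [RHS]addrC subrK -[RHS]h; congr (_ + _).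
rewrite mulr_sumr; apply: eq_bigr => k _; rewrite denl yl.
have -> : p.[x k] = (x k - t * x k) * \prod_(j | j != k) (x k - t * x j).
  rewrite horner_prod (bigD1 k) //= !hornerE; congr (_ * _).
  by apply: eq_bigr => j _; rewrite !hornerE.
rewrite prodf_div.
have dn0 : \prod_(j | j != k) (x k - x j) != 0.
  rewrite prodf_seq_neq0; apply/allP => j _; apply/implyP => njk.
  by rewrite subr_eq0 (inj_eq injx) eq_sym.
by field; rewrite dn0 xn0.
Qed.
End Lagrange.

Section SymmetrizedSums.
Variables (F : fieldType) (t : F).

Definition hl_ratio (a b : F) : F := (a - t * b) / (a - b).

Definition hl_kernel n (y : 'I_n -> F) : F :=
  \prod_(i < n) \prod_(j < n | (i < j)%N) hl_ratio (y i) (y j).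

Definition hl_term n (al : nat -> nat) (y : 'I_n -> F) : F :=
  (\prod_(i < n) y i ^+ al i) * hl_kernel y.

Definition hl_sum n (x : 'I_n -> F) (al : nat -> nat) : F :=
  \sum_(w : 'S_n) hl_term al (x \o w).

Lemma hl_kernel_tperm n (y : 'I_n -> F) (i0 i1 : 'I_n) :
  i1 = i0.+1 :> nat -> injective y ->
  (y i1 - t * y i0) * hl_kernel y =
  - ((y i0 - t * y i1) * hl_kernel (y \o tperm i0 i1)).
Proof.
move=> def_i1 injy; set s := tperm i0 i1.
have ni01 : i0 != i1 by rewrite -val_eqE /= def_i1; lia.
have lt01 : (i0 < i1)%N by rewrite def_i1.
pose D := \prod_(p : 'I_n * 'I_n | (p.1 < p.2)%N && (p != (i0, i1)))
            hl_ratio (y p.1) (y p.2).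
have -> : hl_kernel y = hl_ratio (y i0) (y i1) * D.
  by rewrite /hl_kernel pair_big_dep /= (bigD1 (i0, i1)).
have -> : hl_kernel (y \o s) = hl_ratio (y i1) (y i0) * D.
  rewrite /hl_kernel pair_big_dep /= (bigD1 (i0, i1)) //= /s tpermL tpermR.
  congr (_ * _); pose h (p : 'I_n * 'I_n) := (s p.1, s p.2).
  have hK : involutive h by case=> i j; rewrite /h /= !tpermK.
  rewrite (reindex_inj (inv_inj hK)) /=; apply: eq_big => [[i j]|[i j] _] /=.
    rewrite -/(h (i, j)) (inv_eq hK) /h /= /s tpermL tpermR !xpair_eqE.
    case: tpermP => [->|->|/eqP ni0 /eqP ni1]; case: tpermP => [->|->|/eqP nj0 /eqP nj1];
      rewrite ?eqxx ?andbF ?(negPf ni01) ?(eq_sym i1) ?(negPf ni01) ?(negPf ni0) 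
              ?(negPf ni1) ?(negPf nj0) ?(negPf nj1) ?andbF ?andbT ?ltnn //=;
    move: ni01; repeat match goal with H : is_true (_ != _) |- _ => move: H end;
    rewrite -!val_eqE /= => *; lia.
  by rewrite !tpermK.
have nyi : y i0 - y i1 != 0 by rewrite subr_eq0 (inj_eq injy).
have nyi' : y i1 - y i0 != 0 by rewrite subr_eq0 (inj_eq injy) eq_sym.
by rewrite /hl_ratio; field; rewrite nyi nyi'.
Qed.

Hypothesis two_neq0 : 2%:R != 0 :> F.

(* For al - t be, the terms of w and of w precomposed with (i i+1) cancel. *)
Lemma hl_sum_straighten n (x : 'I_n -> F) (al be : nat -> nat) (i : nat) :
    injective x -> (i.+1 < n)%N ->
    al i.+1 = (al i).+1 -> be i = (al i).+1 -> be i.+1 = al i ->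
    (forall k, k != i -> k != i.+1 -> be k = al k) ->
  hl_sum x al = t * hl_sum x be.
Proof.
move=> injx lti al1 be0 be1 bek.
pose i0 := Ordinal (ltnW lti); pose i1 := Ordinal lti.
have ni01 : i1 != i0 by rewrite -val_eqE /=; lia.
pose U (y : 'I_n -> F) := hl_term al y - t * hl_term be y.
suff : \sum_(w : 'S_n) U (x \o w) = 0.
  by rewrite sumrB -mulr_sumr => /eqP; rewrite subr_eq0 => /eqP.
have UN (w : 'S_n) : U (x \o (tperm i0 i1 * w)%g) = - U (x \o w).
  set y := x \o w.
  have injy : injective y by apply: inj_comp => //; exact: perm_inj.
  pose M (v : 'I_n -> F) := \prod_(k < n | (k != i0) && (k != i1)) v k ^+ al k.
  have UE (v : 'I_n -> F) :
      U v = M v * (v i0 * v i1) ^+ al i * ((v i1 - t * v i0) * hl_kernel v).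
    rewrite /U /hl_term ![\prod_(k < n) v k ^+ _](bigD1 i0) //= !(bigD1 i1 ni01) /=.
    have -> : \prod_(k < n | (k != i0) && (k != i1)) v k ^+ be k = M v.
      by apply: eq_bigr => k /andP[k0 k1]; rewrite bek.
    by rewrite -/(M v) al1 be0 be1 !exprS exprMn; ring.
  have eqy : x \o (tperm i0 i1 * w)%g =1 y \o tperm i0 i1.
    by move=> k; rewrite /= permM.
  have -> : U (x \o (tperm i0 i1 * w)%g) = U (y \o tperm i0 i1).
    rewrite /U /hl_term /hl_kernel; congr (_ * _ - _ * (_ * _));
      by apply: eq_bigr => k _; rewrite ?eqy //; apply: eq_bigr => l _; rewrite !eqy.
  rewrite !UE /= tpermL tpermR (@hl_kernel_tperm _ y i0 i1) // mulrN opprK.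
  congr (_ * _ * _); last by rewrite mulrC.
  by apply: eq_bigr => k /andP[k0 k1]; rewrite /= tpermD // eq_sym.
have : \sum_(w : 'S_n) U (x \o w) = - \sum_(w : 'S_n) U (x \o w).
  rewrite {1}(reindex_inj (mulgI (tperm i0 i1))) -sumrN.
  by apply: eq_bigr => w _; exact: UN.
move/eqP; rewrite -subr_eq0 opprK -mulr2n -mulr_natl mulf_eq0 (negPf two_neq0).
by move/eqP.
Qed.

End SymmetrizedSums.

Section ElementaryCoefficients.
Variable S : comNzRingType.

Lemma coef_prod_linear n (x : 'I_n -> S) r :
  (\prod_(i < n) (1 + x i *: 'X))`_r =
  \sum_(A : {set 'I_n} | #|A| == r) \prod_(i in A) x i.
Proof.
rewrite (eq_bigr (fun i => x i *: 'X + 1)) => [|i _]; last by rewrite addrC.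
rewrite bigA_distr coef_sum [RHS]big_mkcond; apply: eq_bigr => A _.
rewrite -big_mkcond.
have -> : \prod_(i in A) (x i *: 'X) = (\prod_(i in A) x i) *: 'X^#|A| :> {poly S}.
  rewrite -prodr_const -mul_polyC rmorph_prod -big_split.
  by apply: eq_bigr => i _; rewrite -mul_polyC.
by rewrite coefZ coefXn eq_sym; case: eqP => _; rewrite ?mulr1 ?mulr0.
Qed.

End ElementaryCoefficients.

Section NormalizedSums.
Variables (F : fieldType) (t : F).

Lemma big_perm_lift n (f : 'S_n.+1 -> F) :
  \sum_(w : 'S_n.+1) f w = \sum_(k < n.+1) \sum_(w : 'S_n) f (lift_perm ord0 k w).
Proof.
rewrite (partition_big (fun w : 'S_n.+1 => w ord0) xpredT) //=; apply: eq_bigr => k _.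
rewrite (reindex (lift_perm ord0 k)) /=.
  by apply: eq_bigl => w; rewrite lift_perm_id eqxx.
pose u i (s : 'S_n.+1) j := odflt j (unlift (s i) (s (lift i j))).
have uK i (s : 'S_n.+1) j : lift (s i) (u i s j) = s (lift i j).
  rewrite /u; have := neq_lift i j.
  by rewrite -(can_eq (permK s)) => /unlift_some[] ? ? ->.
have inj_u : injective (u ord0 _).
  move=> s; apply: can_inj (u (s ord0) s^-1%g) _ => j.
  by rewrite {1}/u uK !permK liftK.
exists (fun s => perm (inj_u s)) => [s _|s].
  by apply/permP => j; rewrite permE /u lift_perm_lift lift_perm_id liftK.
move/(s _ =P _) => s0; apply/permP => j.
case: (unliftP ord0 j) => [j'|] ->; rewrite ?lift_perm_id //.
by rewrite lift_perm_lift -s0 permE uK.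
Qed.

Lemma big_ord_lift n (k : 'I_n.+1) (f : 'I_n.+1 -> F) :
  \prod_(j < n) f (lift k j) = \prod_(j < n.+1 | j != k) f j.
Proof.
case: n k f => [|n] k f.
  rewrite big_ord0 big1 // => j; rewrite -val_eqE /=.
  by case: j => [[|//] lj]; case: k => [[|//] lk].
rewrite [RHS](reindex (lift k)) /=.
  by apply: eq_bigl => j; rewrite eq_sym neq_lift.
exists (fun j => odflt ord0 (unlift k j)) => [j _|j].
  by rewrite liftK.
by rewrite inE eq_sym => /unlift_some[j' -> ->].
Qed.

Lemma hl_sum0 n (x : 'I_n -> F) : t != 1 -> injective x -> (forall i, x i != 0) ->
  hl_sum t x (fun=> 0%N) = hl_v1 t n.
Proof.
move=> t_neq1; elim: n x => [|n IHn] x injx xn0.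
  rewrite /hl_v1 big_geq // /hl_sum (bigD1 1%g) //= big1 => [|w]; last first.
    by rewrite (_ : w = 1%g) ?eqxx //; apply/permP; case.
  by rewrite /hl_term /hl_kernel !big_ord0 mulr1 addr0.
rewrite /hl_sum big_perm_lift.
have t1 : 1 - t != 0 by rewrite subr_eq0 eq_sym.
rewrite /hl_v1 big_nat_recr //= -/(hl_v1 t n) -(sum_hl_ratio t injx xn0).
rewrite [X in _ * X]mulrC mulKf // mulr_sumr; apply: eq_bigr => k _.
rewrite -(IHn (x \o lift k)) => [|i j /= /injx /lift_inj //|i]; last exact: xn0.
rewrite /hl_sum mulr_suml; apply: eq_bigr => w _.
have term0 m (y : 'I_m -> F) : hl_term t (fun=> 0%N) y = hl_kernel t y.
  by rewrite /hl_term big1 ?mul1r.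
rewrite !term0 /hl_kernel big_ord_recl mulrC.
congr (_ * _).
  apply: eq_bigr => i _; rewrite big_mkcond big_ord_recl /= mul1r [RHS]big_mkcond.
  by apply: eq_bigr => j _; rewrite /= !lift_perm_lift.
rewrite big_mkcond big_ord_recl /= mul1r.
rewrite -(big_ord_lift k (fun j => hl_ratio t (x k) (x j))).
rewrite [RHS](reindex_inj (@perm_inj _ w)); apply: eq_bigr => j _ /=.
by rewrite lift_perm_id lift_perm_lift.
Qed.

Lemma incsum_scale (S : comNzRingType) (z c : S) (G : seq nat -> S) s :
  incsum z (fun u => c * G u) s = c * incsum z G s.
Proof. by elim: s G => [|a s IHs] G //=; rewrite !IHs; ring. Qed.

Lemma incsum_monomial (S : comNzRingType) (z : S) n (y : 'I_n -> S) s : size s = n ->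
  incsum z (fun u => \prod_(i < n) y i ^+ nth 0%N u i) s =
  \prod_(i < n) (1 + z * y i) * \prod_(i < n) y i ^+ nth 0%N s i.
Proof.
elim: s n y => [|a s IHs] n y /= sn; subst n; first by rewrite !big_ord0 mulr1.
have eqG b u : \prod_(i < (size s).+1) y i ^+ nth 0%N (b :: u) i =
    y ord0 ^+ b * \prod_(i < size s) (y \o lift ord0) i ^+ nth 0%N u i.
  by rewrite big_ord_recl.
rewrite !(eq_incsum _ _ (eqG _)) !incsum_scale.
rewrite (IHs _ (y \o lift ord0)) // !big_ord_recl /= exprS.
by ring.
Qed.

Definition hl_word n (x : 'I_n -> F) (s : seq nat) : F :=
  if size s == n then hl_sum t x (nth 0%N s) else 0.

Lemma hl_word_incsum n (x : 'I_n -> F) s : size s = n ->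
  incsum 'X (fun u => (hl_word x u)%:P) s =
  \prod_(i < n) (1 + x i *: 'X) * (hl_word x s)%:P.
Proof.
move=> ss; rewrite (@incsum_size _ _ _ (fun u => \sum_(w : 'S_n)
  (hl_kernel t (x \o w))%:P * (\prod_(i < n) (x (w i))%:P ^+ nth 0%N u i))).
  rewrite incsum_sum /hl_word ss eqxx rmorph_sum mulr_sumr; apply: eq_bigr => w _.
  rewrite incsum_monomial // mulrCA; congr (_ * _).
    rewrite [RHS](reindex_inj (@perm_inj _ w)); apply: eq_bigr => i _.
    by rewrite mulrC mul_polyC.
  rewrite /hl_term rmorphM mulrC; congr (_ * _).
  by rewrite rmorph_prod; apply: eq_bigr => i _; rewrite rmorphXn.
move=> u su; rewrite /hl_word su ss eqxx rmorph_sum; apply: eq_bigr => w _.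
rewrite /hl_term rmorphM mulrC; congr (_ * _).
by rewrite rmorph_prod; apply: eq_bigr => i _; rewrite rmorphXn.
Qed.

Hypothesis two_neq0 : 2%:R != 0 :> F.

Lemma hl_word_straightens n (x : 'I_n -> F) : injective x ->
  straightens t (hl_word x).
Proof.
move=> injx u v a; rewrite /hl_word !size_cat /=.
case: eqP => [sn|_]; last by rewrite mulr0.
have szu : (size u < (size u).+2)%N by lia.
apply: (@hl_sum_straighten _ _ two_neq0 _ _ _ _ (size u)) => //; first by lia.
- by rewrite !nth_cat ltnn subnn ltnNge leqnSn /= subSnn.
- by rewrite !nth_cat ltnn subnn.
- by rewrite !nth_cat ltnn subnn ltnNge leqnSn /= subSnn.
move=> k k0 k1; rewrite !nth_cat; case: ltnP => // lek.
by rewrite (_ : k - size u = (k - (size u).+2).+2)%N //; lia.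
Qed.

End NormalizedSums.

Section PieriCoefficients.
Variables (K : fieldType) (t : K).
Hypothesis t_generic : forall r : nat, (0 < r)%N -> t ^+ r != 1.

Fixpoint hl_norm (n : nat) (c : seq nat) : K :=
  if c is c1 :: c' then hl_v1 t (n - c1) * hl_norm c1 c' else hl_v1 t n.

(* For conjugate partitions c, d of la, mu: the coefficient of P_la in
   e_r P_mu, where r = |la| - |mu|. *)
Fixpoint pieri (c d : seq nat) : K :=
  if c is c1 :: c' then
    (if (head 0%N c' <= head 0%N d <= c1)%N
     then gbin t (c1 - head 0%N c') (c1 - head 0%N d) else 0) * pieri c' (behead d)
  else (all (pred1 0%N) d)%:R.

Lemma t_sub1_neq0 : 1 - t != 0.
Proof. by have := t_generic_sub t_generic 0; rewrite expr1. Qed.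

Lemma hl_v1E n : hl_v1 t n = tfact t n / (1 - t) ^+ n.
Proof.
elim: n => [|n IHn]; first by rewrite /hl_v1 /tfact !big_geq ?expr0 ?divr1.
rewrite /hl_v1 big_nat_recr //= -/(hl_v1 t n) IHn tfactS (exprS (1 - t)).
move: (t ^+ n.+1) => u; by field; rewrite expf_neq0 ?t_sub1_neq0.
Qed.

Lemma hl_v1_neq0 n : hl_v1 t n != 0.
Proof. by rewrite hl_v1E mulf_neq0 ?invr_neq0 ?expf_neq0 ?tfact_neq0 ?t_sub1_neq0. Qed.

Lemma hl_v1_gbin m k : (k <= m)%N ->
  hl_v1 t m = hl_v1 t k * hl_v1 t (m - k) * gbin t m k.
Proof.
move=> lekm; have -> : hl_v1 t m = tfact t m / ((1 - t) ^+ k * (1 - t) ^+ (m - k)).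
  by rewrite hl_v1E -exprD subnKC.
rewrite !hl_v1E gbinE //.
by field; rewrite !expf_neq0 ?tfact_neq0 ?t_sub1_neq0.
Qed.

Lemma hl_norm_neq0 n c : hl_norm n c != 0.
Proof. by elim: c n => [|a c IHc] n /=; rewrite ?mulf_neq0 ?hl_v1_neq0. Qed.

Lemma hl_norm_up_weight n c d : c \in interlacing n d ->
  hl_norm n c * up_weight (gbin t) n c d = hl_norm n d * pieri c d.
Proof.
elim: d n c => [|d1 d IHd] n c.
  case/mapP => c1; rewrite mem_index_iota ltnS => /andP[_ lec1] -> /=.
  by rewrite !subn0 gbinn // (hl_v1_gbin lec1); ring.
move=> /= /allpairsPdep[c1 [c' [c1P c'P ->]]].
have [] := interlacingP c'P; case: c' c'P => // c2 c' c'P _ /= lec2 _ _ _.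
move: c1P; rewrite mem_index_iota ltnS => /andP[led1 lec1].
have /= := IHd _ _ c'P => IH.
rewrite lec2 led1 /=.
have e1 : hl_v1 t (n - d1) = hl_v1 t (c1 - d1) * hl_v1 t (n - c1) * gbin t (n - d1) (c1 - d1).
  rewrite (@hl_v1_gbin (n - d1) (c1 - d1)) ?leq_sub2r //.
  by rewrite (_ : n - d1 - (c1 - d1) = n - c1)%N //; lia.
have e2 : hl_v1 t (c1 - c2) = hl_v1 t (c1 - d1) * hl_v1 t (d1 - c2) * gbin t (c1 - c2) (c1 - d1).
  rewrite (@hl_v1_gbin (c1 - c2) (c1 - d1)) ?leq_sub2l //.
  by rewrite (_ : c1 - c2 - (c1 - d1) = d1 - c2)%N //; lia.
rewrite e1 e2.
transitivity (hl_v1 t (c1 - d1) * hl_v1 t (n - c1) * gbin t (n - d1) (c1 - d1) *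
  gbin t (c1 - c2) (c1 - d1) * (hl_norm d1 d * pieri (c2 :: c') d)); last by rewrite /=; ring.
by rewrite /= -IH; ring.
Qed.

Lemma rmorph_up_weight (S : comNzRingType) (f : {rmorphism K -> S}) n c d :
  up_weight (fun m k => f (gbin t m k)) n c d = f (up_weight (gbin t) n c d).
Proof.
elim: c n d => [|c1 c IHc] n [|d1 d] /=; rewrite ?rmorph0 //.
by rewrite IHc rmorphM.
Qed.

Variables (F : fieldType) (phi : {rmorphism K -> F}).
Hypothesis two_neq0 : 2%:R != 0 :> F.

Definition hl_vars n (x : 'I_n -> F) (c : seq nat) : F :=
  (phi (hl_norm n c))^-1 * hl_word (phi t) x (conj_word n c).

Lemma pieri_vars n (x : 'I_n -> F) r d :
    injective x -> sorted geq d -> (head 0%N d <= n)%N ->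
  (\prod_(i < n) (1 + x i *: 'X))`_r * hl_vars x d =
  \sum_(c <- interlacing n d | sumn c == (sumn d + r)%N) phi (pieri c d) * hl_vars x c.
Proof.
move=> injx srt led.
rewrite /hl_vars mulrCA -coefMC -hl_word_incsum ?size_conj_word //.
pose bn m k : {poly F} := (phi (gbin t m k))%:P.
rewrite (@incsum_conj_word _ 'X (phi t)%:P bn) //; first last.
- by move=> u v a; rewrite -polyCM (hl_word_straightens (phi t) two_neq0 injx).
- by move=> m k; rewrite /bn gbinS // rmorphD rmorphM rmorphXn polyCD polyCM rmorphXn.
- by move=> m k ltmk; rewrite /bn gbin_small // rmorph0.
- by move=> m; rewrite /bn gbin0 // rmorph1.
rewrite coef_sum mulr_sumr [RHS]big_mkcond; apply: eq_big_seq => c cP.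
rewrite (rmorph_up_weight (polyC \o phi)) /= coefMC coefCM coefXn.
have [_ _ _ lesum _] := interlacingP cP.
rewrite (_ : (r == sumn c - sumn d)%N = (sumn c == sumn d + r)%N); last by lia.
case: eqP => _; last by rewrite mulr0 mul0r mulr0.
rewrite mulr1 !mulrA; congr (_ * _).
apply: (mulfI (_ : phi (hl_norm n d) != 0)); first by rewrite fmorph_eq0 hl_norm_neq0.
rewrite mulVKf ?fmorph_eq0 ?hl_norm_neq0 // mulrA -rmorphM -hl_norm_up_weight //.
by rewrite rmorphM mulrAC mulfV ?mul1r // fmorph_eq0 hl_norm_neq0.
Qed.

End PieriCoefficients.

(** * Partitions *)

Section Partitions.

Lemma geq_trans : transitive geq.
Proof. by move=> y x z yx zy; exact: leq_trans zy yx. Qed.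

Fact mkpart_subproof (s : seq nat) :
  let s' := sort geq (filter (leq 1) s) in sorted geq s' && all (leq 1) s'.
Proof.
apply/andP; split; first by apply: sort_sorted => x y; exact: leq_total.
by rewrite all_sort filter_all.
Qed.

Definition mkpart (s : seq nat) : intpart := IntPart (mkpart_subproof s).

Lemma mkpartE s : sorted geq s -> mkpart s = filter (leq 1) s :> seq nat.
Proof.
move=> srt; rewrite /= sorted_sort //; first exact: geq_trans.
by apply: sorted_filter => //; exact: geq_trans.
Qed.

Lemma intpart_sorted (c : intpart) : sorted geq c.
Proof. by case/andP: (partsP c). Qed.

Lemma intpart_gt0 (c : intpart) : all (leq 1) c.
Proof. by case/andP: (partsP c). Qed.

Lemma intpart_inj (c d : intpart) : c = d :> seq nat -> c = d.
Proof. exact: val_inj. Qed.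

Lemma mkpartK (c : intpart) : mkpart c = c.
Proof.
apply: intpart_inj; rewrite mkpartE ?intpart_sorted //.
by apply/all_filterP; exact: intpart_gt0.
Qed.

Lemma mkpart_perm s1 s2 : perm_eq s1 s2 -> mkpart s1 = mkpart s2.
Proof.
move=> eqs; apply: intpart_inj => /=; apply/perm_sortP.
- by move=> x y; exact: leq_total.
- exact: geq_trans.
- by move=> x y /andP[xy yx]; apply/eqP; rewrite eqn_leq; apply/andP; split.
- exact: perm_filter.
Qed.

Lemma sumn_mkpart s : sumn (mkpart s) = sumn s.
Proof.
rewrite (perm_sumn (_ : perm_eq _ (filter (leq 1) s))) /=; last by rewrite perm_sort.
by elim: s => [|[|a] s IHs] //=; rewrite IHs.
Qed.

Lemma sorted_geq_zeros s : sorted geq s ->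
  s = [seq i <- s | (0 < i)%N] ++ nseq (count_mem 0%N s) 0%N.
Proof.
elim: s => [|[|a] s IHs] //= srt.
  have z : all (pred1 0%N) s.
    by apply: sub_all (sorted_geq_head srt) => i /=; rewrite leqn0.
  rewrite (_ : filter _ s = [::]) /=; last first.
    by rewrite -(filter_pred0 s); apply: eq_in_filter => i /(allP z) /eqP ->.
  by rewrite (all_pred1P _ _ z) count_nseq /= mul1n.
by rewrite {1}(IHs (path_sorted srt)).
Qed.

Lemma sorted_mkpart s : sorted geq s -> s = mkpart s ++ nseq (count_mem 0%N s) 0%N.
Proof. by move=> srt; rewrite mkpartE //; exact: sorted_geq_zeros. Qed.

Definition pad (n : nat) (s : seq nat) : seq nat := mkseq (nth 0%N s) n.

Lemma pad_cons n a s : pad n.+1 (a :: s) = a :: pad n s.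
Proof. by rewrite /pad /mkseq /= -[1%N]add1n iotaDl -map_comp. Qed.

Lemma pad_head n s : pad n.+1 s = head 0%N s :: pad n (behead s).
Proof.
case: s => [|a s]; last exact: pad_cons.
rewrite /pad /mkseq /= -[1%N]add1n iotaDl -map_comp; congr (_ :: _).
by apply: eq_map => i /=; rewrite !nth_nil.
Qed.

Lemma nth_pad n s i : (size s <= n)%N -> nth 0%N (pad n s) i = nth 0%N s i.
Proof.
move=> les; have [ltin|lein] := ltnP i n; first by rewrite nth_mkseq.
by rewrite !nth_default // ?size_mkseq // (leq_trans les).
Qed.

Lemma pad_cat_zeros n s k : (size s + k = n)%N -> pad n s = s ++ nseq k 0%N.
Proof.
move=> szs; apply: (@eq_from_nth _ 0%N); first by rewrite size_mkseq size_cat size_nseq.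
move=> i; rewrite size_mkseq => ltin; rewrite nth_mkseq // nth_cat nth_nseq if_same.
by case: ltnP => // ?; rewrite nth_default.
Qed.

Lemma pad_mkpart n s : sorted geq s -> size s = n -> pad n (mkpart s) = s.
Proof.
move=> srt szs; rewrite (@pad_cat_zeros _ _ (count_mem 0%N s)); last first.
  by rewrite -szs [in RHS](sorted_mkpart srt) size_cat size_nseq.
by rewrite -sorted_mkpart.
Qed.

Lemma size_mkpart s : (size (mkpart s) <= size s)%N.
Proof. by rewrite size_sort size_filter count_size. Qed.

Lemma mkpart_pad n (c : intpart) : (size c <= n)%N -> mkpart (pad n c) = c.
Proof.
move=> lec; rewrite -[RHS]mkpartK; apply: intpart_inj => /=; congr (sort _ _).
rewrite (@pad_cat_zeros _ _ (n - size c)%N) ?subnKC // filter_cat.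
by rewrite (_ : filter _ (nseq _ _) = [::]) ?cats0 //; elim: (n - _)%N.
Qed.

Lemma sumn_pad n s : (size s <= n)%N -> sumn (pad n s) = sumn s.
Proof.
by move=> les; rewrite (@pad_cat_zeros _ _ (n - size s)%N) ?subnKC // sumn_cat sumn_nseq mul0n addn0.
Qed.

Lemma head_mkpart s : sorted geq s -> head 0%N (mkpart s) = head 0%N s.
Proof.
move=> srt; rewrite [in RHS](sorted_mkpart srt).
by case: (mkpart s : seq nat) => //=; case: (count_mem _ _).
Qed.

Definition conjp (s : seq nat) : intpart := mkpart (conj_word (head 0%N s) s).

Lemma leq_head s i : sorted geq s -> i \in s -> (i <= head 0%N s)%N.
Proof.
case: s => //= a s srt; rewrite inE => /orP[/eqP -> //|].
by move/(allP (sorted_geq_head srt)).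
Qed.

Lemma conjpE s : sorted geq s -> conjp s = conj_word (head 0%N s) s :> seq nat.
Proof.
move=> srt; have srt' : sorted geq (conj_word (head 0%N s) s).
  rewrite /conj_word /mkseq; apply: (@homo_sorted _ _ _ leq).
    by move=> i j leij; apply: sub_count => v; exact: leq_ltn_trans.
  exact: iota_sorted.
rewrite /conjp mkpartE //; apply/all_filterP/allP => _ /mapP[i + ->].
rewrite mem_iota add0n => /andP[_ lti]; rewrite -has_count.
apply/hasP; exists (head 0%N s) => //; case: (s) lti => //= a s' _.
exact: mem_head.
Qed.

Lemma size_conjp s : sorted geq s -> size (conjp s) = head 0%N s.
Proof. by move=> srt; rewrite conjpE // size_conj_word. Qed.

Lemma nth_conjp s i : sorted geq s ->
  nth 0%N (conjp s) i = count (fun v => (i < v)%N) s.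
Proof.
move=> srt; rewrite conjpE //; have [lti|lei] := ltnP i (head 0%N s).
  by rewrite nth_mkseq.
rewrite nth_default ?size_conj_word //; apply/esym/eqP.
rewrite -leqn0 leqNgt -has_count; apply/hasPn => v vs; rewrite -leqNgt.
exact: leq_trans (leq_head srt vs) lei.
Qed.

Lemma count_gt_sorted s i j : sorted geq s ->
  (i < count (fun v => (j < v)%N) s)%N = (j < nth 0%N s i)%N.
Proof.
elim: s i => [|a s IHs] i srt /=; first by rewrite nth_nil.
have /= srt' := path_sorted srt.
case: i => [|i] /=; last first.
  rewrite -IHs //; case: (ltnP j a) => [|leaj]; first by rewrite add1n ltnS.
  rewrite add0n (_ : count _ s = 0%N) //; apply/eqP; rewrite -leqn0 leqNgt -has_count.
  by apply/hasPn => v /(allP (sorted_geq_head srt)) /= leva; rewrite -leqNgt (leq_trans leva).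
case: (ltnP j a) => // leaj; rewrite add0n -has_count; apply/negbTE/hasPn => v.
by move/(allP (sorted_geq_head srt)) => /= leva; rewrite -leqNgt (leq_trans leva).
Qed.

Lemma count_iota_lt m k : count (fun v => (v < k)%N) (iota 0 m) = minn m k.
Proof.
elim: m => [|m IHm]; first by rewrite min0n.
by rewrite -addn1 iotaD count_cat IHm /=; case: ltnP => ?; lia.
Qed.

Lemma conjpK (c : intpart) : conjp (conjp c) = c.
Proof.
have srt := intpart_sorted c; have srt' := intpart_sorted (conjp c).
apply: intpart_inj; apply: (@eq_from_nth _ 0%N).
  rewrite size_conjp // -nth0 nth_conjp // -[RHS]count_predT.
  by apply: eq_in_count => v /(allP (intpart_gt0 c)).
move=> i _; rewrite nth_conjp // conjpE // count_map.
rewrite (eq_count (a2 := fun v => v < nth 0%N c i)%N) => [|v]; last first.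
  exact: count_gt_sorted.
rewrite count_iota_lt; apply/minn_idPr; rewrite -nth0.
have [ltic|leci] := ltnP i (size c); last by rewrite nth_default.
by rewrite nth0 leq_head // mem_nth.
Qed.

Lemma conjp_inj (c d : intpart) : conjp c = conjp d -> c = d.
Proof. by move=> eqcd; rewrite -(conjpK c) eqcd conjpK. Qed.

Lemma conjp_mkpart s : sorted geq s -> conjp (mkpart s) = conjp s.
Proof.
move=> srt; apply: intpart_inj; apply: (@eq_from_nth _ 0%N).
  by rewrite !size_conjp ?head_mkpart // intpart_sorted.
move=> i _; rewrite !nth_conjp ?intpart_sorted // [in RHS](sorted_mkpart srt).
rewrite count_cat [X in (_ + X)%N](_ : _ = 0%N) ?addn0 //.
by elim: (count_mem _ _).
Qed.

Definition partitions (n : nat) : seq intpart :=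
  [seq c : intpart <- undup [seq mkpart (map val (tval s)) | s <- enum {: n.-tuple 'I_n.+1}]
      | sumn c == n].

Lemma partitions_uniq n : uniq (partitions n).
Proof. by rewrite filter_uniq // undup_uniq. Qed.

Lemma size_leq_sumn (c : intpart) : (size c <= sumn c)%N.
Proof.
elim: (parts c) (intpart_gt0 c) => //= a s IHs /andP[a0 /IHs les].
by rewrite -add1n leq_add.
Qed.

Lemma leq_sumn (s : seq nat) i : i \in s -> (i <= sumn s)%N.
Proof.
elim: s => //= a s IHs; rewrite inE => /orP[/eqP->|/IHs]; first exact: leq_addr.
by move/leq_trans; apply; exact: leq_addl.
Qed.

Lemma mem_partitions n (c : intpart) : (c \in partitions n) = (sumn c == n).
Proof.
rewrite mem_filter; case: eqP => //= sumc; rewrite mem_undup; apply/mapP.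
have lec : (size c <= n)%N by rewrite -sumc size_leq_sumn.
exists [tuple inord (nth 0%N c i) | i < n]; first exact: mem_enum.
rewrite -[LHS](mkpart_pad lec); congr mkpart.
apply: (@eq_from_nth _ 0%N); first by rewrite size_mkseq size_map size_tuple.
move=> i; rewrite size_mkseq => ltin.
rewrite nth_mkseq // (nth_map (inord 0)) ?size_tuple //.
rewrite -[i]/(val (Ordinal ltin)) -tnth_nth tnth_mktuple inordK //= ltnS.
have [ltic|leci] := ltnP i (size c); last by rewrite nth_default.
by rewrite -sumc leq_sumn // mem_nth.
Qed.

Definition partitions_upto (n : nat) : seq intpart :=
  flatten [seq partitions i | i <- iota 0 n.+1].

Lemma mem_partitions_upto n (c : intpart) : (c \in partitions_upto n) = (sumn c <= n)%N.
Proof.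
apply/flatten_mapP/idP => [[i]|lec].
  by rewrite mem_iota mem_partitions => /andP[_ lein] /eqP ->.
by exists (sumn c); rewrite ?mem_partitions ?mem_iota.
Qed.

Lemma partitions_upto_uniq n : uniq (partitions_upto n).
Proof.
rewrite /partitions_upto; elim: n.+1 => // m IHm.
rewrite -addn1 iotaD map_cat flatten_cat cat_uniq IHm /= cats0 partitions_uniq andbT.
apply/hasPn => c; rewrite mem_partitions => /eqP sumc; apply/flatten_mapP => -[i].
by rewrite mem_iota mem_partitions sumc => /andP[_ +] /eqP eqm; lia.
Qed.

Lemma big_partitions_upto (R : Type) (idx : R) (op : Monoid.law idx) n (f : intpart -> R) :
  \big[op/idx]_(c <- partitions_upto n) f c =
  \big[op/idx]_(0 <= i < n.+1) \big[op/idx]_(c <- partitions i) f c.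
Proof. by rewrite big_flatten big_map. Qed.

Lemma big_partitions_sub (V : nmodType) n m (f : intpart -> V) : (n <= m)%N ->
  \sum_(c <- partitions n) f c =
  \sum_(c <- partitions_upto m) (if sumn c == n then f c else 0).
Proof.
move=> lenm; rewrite -big_mkcond -[RHS]big_filter; apply: perm_big.
apply: uniq_perm => [||c].
- exact: partitions_uniq.
- by rewrite filter_uniq // partitions_upto_uniq.
by rewrite mem_partitions mem_filter mem_partitions_upto; case: eqP => // ->.
Qed.

End Partitions.

Section InterlacingSums.
Variables (K : fieldType) (t : K).
Hypothesis t_generic : forall r : nat, (0 < r)%N -> t ^+ r != 1.

Lemma pieri_zerosl c d k : pieri t (c ++ nseq k 0%N) d = pieri t c d.
Proof.
elim: c d => [|a c IHc] d /=; last by rewrite IHc; case: (c); case: (k).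
elim: k d => [|k IHk] d //=; rewrite IHk.
rewrite (_ : head 0%N (nseq k 0%N) = 0%N); last by case: (k).
case: d => [|[|a] d] /=; rewrite ?gbin0 ?mul1r ?mul0r //.
Qed.

Lemma pieri_zerosr c d k : pieri t c (d ++ nseq k 0%N) = pieri t c d.
Proof.
elim: c d k => [|a c IHc] d k /=.
  by rewrite all_cat (_ : all _ (nseq k 0%N) = true) ?andbT //; elim: (k).
case: d => [|b d] /=; last by rewrite IHc.
rewrite (_ : head 0%N (nseq k 0%N) = 0%N); last by case: (k).
by rewrite (_ : behead (nseq k 0%N) = [::] ++ nseq k.-1 0%N) ?IHc //; case: (k).
Qed.

Lemma pieri_mkpartl s d : sorted geq s -> pieri t (mkpart s) d = pieri t s d.
Proof. by move=> srt; rewrite [in RHS](sorted_mkpart srt) pieri_zerosl. Qed.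

Lemma pieri_mkpartr c s : sorted geq s -> pieri t c (mkpart s) = pieri t c s.
Proof. by move=> srt; rewrite [in RHS](sorted_mkpart srt) pieri_zerosr. Qed.

Lemma interlacing_uniq n d : uniq (interlacing n d).
Proof.
elim: d n => [|d1 d IHd] n.
  by rewrite map_inj_uniq ?iota_uniq // => i j [].
apply: allpairs_uniq => //; first exact: iota_uniq.
by move=> [i u] [j v] _ _ /= [-> ->].
Qed.

Lemma mem_interlacing_nil n c1 : ([:: c1] \in interlacing n [::]) = (c1 <= n)%N.
Proof.
apply/mapP/idP => [[k + [->]]|lec]; first by rewrite mem_index_iota ltnS.
by exists c1; rewrite ?mem_index_iota.
Qed.

Lemma mem_interlacing_cons n c1 c d1 d :
  (c1 :: c \in interlacing n (d1 :: d)) = (d1 <= c1 <= n)%N && (c \in interlacing d1 d).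
Proof.
apply/allpairsP/idP => [[[k u] [/= + uP [-> ->]]]|/andP[c1P cP]].
  by rewrite mem_index_iota ltnS => ->.
by exists (c1, c); rewrite mem_index_iota ltnS.
Qed.

Lemma pieri_neq0_interlacing n (c d : seq nat) :
    all (leq 1) c -> all (leq 1) d -> (head 0%N c <= n)%N -> pieri t c d != 0 ->
  (size c <= (size d).+1)%N /\ pad (size d).+1 c \in interlacing n d.
Proof.
elim: d c n => [|d1 d IHd] [|c1 c] n.
- by rewrite mem_interlacing_nil.
- case: c => [|[|c2] c] cp _ lec //=.
  + by rewrite mem_interlacing_nil.
  + by move: cp; rewrite /= andbF.
  + by rewrite mul0r eqxx.
- by case: d1 => //= d1 _ _ _; rewrite eqxx.
rewrite pad_cons mem_interlacing_cons /= => /andP[c0 cp] /andP[d0 dp] lec.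
case: ifP => [/andP[lecd ledc]|_]; last by rewrite mul0r eqxx.
rewrite mulf_eq0 negb_or => /andP[_ /(IHd _ _ cp dp lecd)[szc pc]].
by rewrite ledc lec.
Qed.

Lemma big_interlacing (V : nmodType) (G : K -> intpart -> V) n (d : intpart) D :
    (forall c, G 0 c = 0) ->
  \sum_(c <- interlacing n d | sumn c == D) G (pieri t c d) (mkpart c) =
  \sum_(c <- partitions D | (head 0%N c <= n)%N) G (pieri t c d) c.
Proof.
move=> G0.
pose ok (c : intpart) := (size c <= (size d).+1)%N && (pad (size d).+1 c \in interlacing n d).
rewrite [RHS](bigID ok) /= [X in _ = _ + X]big1 ?addr0 => [|c /andP[lec nok]]; last first.
  have [-> //|] := eqVneq (pieri t c d) 0.
  move/(pieri_neq0_interlacing (intpart_gt0 c) (intpart_gt0 d) lec) => [sc pc].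
  by rewrite /ok sc pc in nok.
transitivity (\sum_(c <- [seq mkpart c | c <- interlacing n d & sumn c == D]) G (pieri t c d) c).
  rewrite big_map big_filter big_seq_cond [RHS]big_seq_cond.
  apply: eq_bigr => c /andP[cP _].
  by have [_ _ _ _ srt] := interlacingP cP; rewrite pieri_mkpartl.
rewrite -big_filter; apply: perm_big; apply: uniq_perm.
- rewrite map_inj_in_uniq ?filter_uniq ?interlacing_uniq // => c c'.
  rewrite !mem_filter => /andP[_ /interlacingP[sc _ _ _ srt]].
  move=> /andP[_ /interlacingP[sc' _ _ _ srt']] eqcc.
  by rewrite -(pad_mkpart srt sc) eqcc pad_mkpart.
- by rewrite filter_uniq // partitions_uniq.
move=> c; rewrite mem_filter mem_partitions; apply/mapP/idP => [[s]|].
  rewrite mem_filter => /andP[/eqP sums sP] ->.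
  have [szs les _ _ srt] := interlacingP sP.
  rewrite /ok head_mkpart // les -szs size_mkpart pad_mkpart // sP.
  by rewrite sumn_mkpart sums eqxx.
case/andP=> /andP[lec /andP[szc pc]] /eqP sumc.
by exists (pad (size d).+1 c); rewrite ?mkpart_pad // mem_filter pc sumn_pad // sumc eqxx.
Qed.

(* The sequences d of the length of c with c_1 >= d_1 >= c_2 >= d_2 >= ... *)
Fixpoint interlaced (c : seq nat) : seq (seq nat) :=
  if c is c1 :: c' then
    [seq d1 :: d | d1 <- index_iota (head 0%N c') c1.+1, d <- interlaced c']
  else [:: [::]].

Lemma interlaced_uniq c : uniq (interlaced c).
Proof.
elim: c => [|c1 c IHc] //=; apply: allpairs_uniq => //; first exact: iota_uniq.
by move=> [i u] [j v] _ _ /= [-> ->].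
Qed.

Lemma interlacedP c d : d \in interlaced c ->
  [/\ size d = size c, (head 0%N d <= head 0%N c)%N, (sumn d <= sumn c)%N & sorted geq d].
Proof.
elim: c d => [|c1 c IHc] d; first by rewrite inE => /eqP ->.
move=> /allpairsPdep[d1 [d' [+ /IHc[szd led sumd srt] ->]]].
rewrite mem_index_iota ltnS => /andP[lec ged] /=; split=> //.
- by rewrite szd.
- by rewrite leq_add.
case: d' led srt {szd sumd} => //= d2 d' led ->; rewrite andbT.
exact: leq_trans led lec.
Qed.

Lemma pieri_neq0_interlaced (c d : seq nat) : all (leq 1) d -> pieri t c d != 0 ->
  (size d <= size c)%N /\ pad (size c) d \in interlaced c.
Proof.
elim: c d => [|c1 c IHc] d dp /=.
  case: d dp => [|d1 d] //= /andP[d1p _]; case: d1 d1p => //= d1 _.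
  by rewrite eqxx.
case: ifP => [/andP[lecd ledc]|_]; last by rewrite mul0r eqxx.
have bp : all (leq 1) (behead d) by case: d dp {lecd ledc} => //= ? ? /andP[].
rewrite mulf_eq0 negb_or => /andP[_ /(IHc _ bp)[szd pd]].
split; first by case: d szd {dp bp pd lecd ledc} => //= ? ?; rewrite ltnS.
rewrite pad_head.
apply/allpairsP; exists (head 0%N d, pad (size c) (behead d)); split=> //=.
by rewrite mem_index_iota lecd ltnS.
Qed.

Lemma big_interlaced (V : nmodType) (G : K -> intpart -> V) n (c : intpart) :
    (forall d, G 0 d = 0) -> (sumn c <= n)%N ->
  \sum_(d <- partitions_upto n) G (pieri t c d) d =
  \sum_(d <- interlaced c) G (pieri t c d) (mkpart d).
Proof.
move=> G0 lecn.
pose ok (d : intpart) := (size d <= size c)%N && (pad (size c) d \in interlaced c).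
rewrite (bigID ok) /= [X in _ + X]big1 ?addr0 => [|d nok]; last first.
  have [-> //|] := eqVneq (pieri t c d) 0.
  move/(pieri_neq0_interlaced (intpart_gt0 d)) => [sd pd].
  by rewrite /ok sd pd in nok.
transitivity (\sum_(d <- [seq mkpart d | d <- interlaced c]) G (pieri t c d) d); last first.
  rewrite big_map; apply: eq_big_seq => d dP.
  by have [_ _ _ srt] := interlacedP dP; rewrite pieri_mkpartr.
rewrite -big_filter; apply: perm_big; apply: uniq_perm.
- by rewrite filter_uniq // partitions_upto_uniq.
- rewrite map_inj_in_uniq ?interlaced_uniq // => d d'.
  move=> /interlacedP[sd _ _ srt] /interlacedP[sd' _ _ srt'] eqdd.
  by rewrite -(pad_mkpart srt sd) eqdd pad_mkpart.
move=> d; rewrite mem_filter mem_partitions_upto; apply/idP/mapP => [|[s sP ->]].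
  by case/andP=> /andP[szd pd] _; exists (pad (size c) d); rewrite ?mkpart_pad.
have [szs _ sums srt] := interlacedP sP.
by rewrite /ok -szs size_mkpart pad_mkpart // sP sumn_mkpart (leq_trans sums).
Qed.

End InterlacingSums.

(** * Power sums and elementary symmetric functions *)

Section NewtonIdentities.
Variable S : comNzRingType.
Implicit Types e p : nat -> S.

Definition newton_upto (n : nat) e p := forall r, (r < n)%N ->
  r.+1%:R * e r.+1 = \sum_(i < r.+1) (-1) ^+ i * (e (r - i)%N * p i.+1).

Lemma newton_psum n e p r : e 0%N = 1 -> newton_upto n e p -> (r < n)%N ->
  p r.+1 = (-1) ^+ r * (r.+1%:R * e r.+1 -
    \sum_(i < r) (-1) ^+ i * (e (r - i)%N * p i.+1)).
Proof.
move=> e0 Np ltrn; rewrite Np // big_ord_recr /= subnn e0 mul1r.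
by rewrite addrAC subrr add0r signrMK.
Qed.

Lemma newton_upto_psum n e p p' : e 0%N = 1 ->
  newton_upto n e p -> newton_upto n e p' -> forall r, (r < n)%N -> p r.+1 = p' r.+1.
Proof.
move=> e0 Np Np'; elim/ltn_ind => r IHr ltrn.
rewrite (newton_psum e0 Np ltrn) (newton_psum e0 Np' ltrn); congr (_ * (_ - _)).
by apply: eq_bigr => i _; rewrite -IHr // (ltn_trans (ltn_ord i)).
Qed.

Lemma eq_newton_upto n e e' p : (forall i, (i <= n)%N -> e i = e' i) ->
  newton_upto n e p -> newton_upto n e' p.
Proof.
move=> eqe Np r ltrn; rewrite -eqe // Np //; apply: eq_bigr => i _.
by rewrite eqe //; lia.
Qed.

Lemma coef_mul_linear (a : S) (P : {poly S}) r :
  ((1 + a *: 'X) * P)`_r = P`_r + (if r is r'.+1 then a * P`_r' else 0).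
Proof.
rewrite mulrDl mul1r coefD -scalerAl coefZ coefXM.
by case: r => [|r] /=; rewrite ?mulr0.
Qed.

Lemma newton_prod (s : seq S) n :
  newton_upto n (fun r => (\prod_(a <- s) (1 + a *: 'X))`_r)
                (fun r => \sum_(a <- s) a ^+ r).
Proof.
move=> r _; elim: s r => [|a s IHs] r.
  rewrite big_nil coef1 mulr0 big1 // => i _.
  by rewrite big_nil !mulr0.
rewrite big_cons coef_mul_linear mulrDr IHs.
set P := \prod_(_ <- _) _ in IHs *.
pose q k := \sum_(b <- s) b ^+ k.
pose u k := if k is k'.+1 then a * P`_k' else 0.
rewrite [RHS](eq_bigr (fun i : 'I_r.+1 => (-1) ^+ i * (P`_(r - i) * q i.+1) +
    ((-1) ^+ i * (u (r - i)%N * q i.+1) +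
    ((-1) ^+ i * (((1 + a *: 'X) * P)`_(r - i) * a ^+ i.+1))))); last first.
  by move=> i _; rewrite coef_mul_linear [in LHS]big_cons -/(q i.+1) -/(u _); ring.
rewrite !big_split; congr (_ + _).
rewrite big_ord_recr /= subnn mul0r mulr0 addr0.
have -> : \sum_(i < r.+1) (-1) ^+ i * (((1 + a *: 'X) * P)`_(r - i) * a ^+ i.+1) = a * P`_r.
  under eq_bigr do rewrite coef_mul_linear -/(u _) mulrDl mulrDr.
  rewrite big_split /= big_ord_recl [X in _ + X]big_ord_recr /=.
  rewrite subnn mul0r mulr0 addr0 subn0 expr0 mul1r expr1 -addrA -big_split /=.
  rewrite big1 ?addr0 1?mulrC // => i _.
  rewrite /bump /= add1n subnS; rewrite /u; case: (r - i)%N (subn_gt0 i r) => [|k _] /=.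
    by rewrite ltn_ord.
  by rewrite !exprS; ring.
have -> : \sum_(i < r) (-1) ^+ i * (u (r - i)%N * q i.+1) =
    r%:R * (a * P`_r).
  case: r => [|r]; first by rewrite big_ord0 mul0r.
  rewrite mulrCA IHs mulr_sumr; apply: eq_bigr => i _.
  by rewrite subSn ?leq_ord // /u /q /=; ring.
by rewrite -natr1; ring.
Qed.

End NewtonIdentities.

Lemma newton_upto_elem (S : fieldType) (e e' p : nat -> S) n :
  [pchar S] =i pred0 -> e 0%N = e' 0%N ->
  newton_upto n e p -> newton_upto n e' p -> forall r, (r <= n)%N -> e r = e' r.
Proof.
move=> char0 e0 Ne Ne'; elim/ltn_ind => -[//|r] IHr ltrn.
have /mulfI : r.+1%:R != 0 :> S by have/pcharf0P -> := char0.
apply; rewrite (Ne r ltrn) (Ne' r ltrn); apply: eq_bigr => i _.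
by rewrite IHr //; lia.
Qed.

Lemma rmorph_newton_upto (S S' : comNzRingType) (f : {rmorphism S -> S'}) e p n :
  newton_upto n e p -> newton_upto n (f \o e) (f \o p).
Proof.
move=> Np r ltrn; rewrite /= -(rmorph_nat f) -rmorphM Np // rmorph_sum.
by apply: eq_bigr => i _; rewrite !rmorphM rmorphXn rmorphN1.
Qed.

Section PowerSumSpecializations.
Variables (K : fieldType) (S : comNzRingType).

Definition psum_monomial (v : nat -> S) (m : {cmonom nat}) : S :=
  \prod_(i <- finsupp m) v i.+1 ^+ m i.

Lemma psum_monomialE v (E : {fset nat}) (m : {cmonom nat}) : (finsupp m `<=` E)%fset ->
  psum_monomial v m = \prod_(i <- E) v i.+1 ^+ m i.
Proof.
move=> sE; apply: big_fset_incl => // i _; rewrite -cmE_eq0 => /eqP ->.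
by rewrite expr0.
Qed.

Fact psum_monomial_subproof v : monalg.mmorphism (psum_monomial v).
Proof.
split=> [m1 m2|]; last by rewrite /psum_monomial mdom1 big_seq_fset0.
rewrite (psum_monomialE v (fsubsetUl (finsupp m1) (finsupp m2))).
rewrite (psum_monomialE v (fsubsetUr (finsupp m1) (finsupp m2))).
rewrite /psum_monomial mdomD -big_split /=.
by apply: eq_bigr => i _; rewrite cmM exprD.
Qed.

HB.instance Definition _ v :=
  monalg.isMultiplicative.Build {cmonom nat} S (psum_monomial v) (psum_monomial_subproof v).

Variables (f : {rmorphism K -> S}) (v : nat -> S).

HB.instance Definition _ :=
  GRing.RMorphism.copy (psum_spec f v) (monalg.mmap f (psum_monomial v)).

Lemma psum_specU c m : psum_spec f v << c *g m >> = f c * psum_monomial v m.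
Proof. exact: monalg.mmapU. Qed.

Lemma psum_specZ c (F : symfun K) : psum_spec f v (c *: F) = f c * psum_spec f v F.
Proof. exact: (@monalg.mmapZ _ _ _ f (psum_monomial v)). Qed.

End PowerSumSpecializations.

Section SymmetricFunctions.
Variable K : fieldType.
Hypothesis char0 : [pchar K] =i pred0.
Local Notation symfun := (symfun K).

Lemma natr_char0_neq0 n : n.+1%:R != 0 :> K.
Proof. by have/pcharf0P -> := char0. Qed.

Definition psum (r : nat) : symfun := << @ucm nat r.-1 >>%R.

Lemma psum_spec_psum (S : comNzRingType) (f : {rmorphism K -> S}) v r :
  psum_spec f v (psum r.+1) = v r.+1.
Proof.
by rewrite psum_specU rmorph1 mul1r /psum_monomial mdomU big_seq_fset1 cmUU expr1.
Qed.

Lemma rmorph_psum_spec (S S' : comNzRingType) (g : {rmorphism S -> S'})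
    (f : K -> S) (f' : K -> S') v v' (F : symfun) :
    (forall c, g (f c) = f' c) -> (forall r, g (v r.+1) = v' r.+1) ->
  g (psum_spec f v F) = psum_spec f' v' F.
Proof.
move=> gf gv; rewrite /psum_spec !monalg.mmapE rmorph_sum; apply: eq_bigr => m _.
rewrite rmorphM gf rmorph_prod; congr (_ * _); apply: eq_bigr => i _.
by rewrite rmorphXn gv.
Qed.

Lemma monalgUM (m1 m2 : {cmonom nat}) :
  (<< m1 >> : symfun) * << m2 >> = << mmul m1 m2 >>.
Proof.
by rewrite (malgMEw msuppU_le msuppU_le) !big_seq_fset1 !mcoeffUU mulr1.
Qed.

Lemma malgUZ c (m : {cmonom nat}) : c *: (<< m >> : symfun) = << c *g m >>.
Proof.
apply/malgP => k.
rewrite monalg.mcoeffZ [in RHS]monalg.mcoeffU.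
have -> : monalg.mcoeff k (<< m >> : symfun) = 1 *+ (m == k).
  exact: monalg.mcoeffU.
by rewrite mulrnAr mulr1.
Qed.

Lemma psum_spec_id (F : symfun) (N := \max_(m <- monalg.msupp F) \max_(i <- finsupp m) i.+1) v :
  (forall r, (r < N)%N -> v r.+1 = psum r.+1) ->
  psum_spec (fun c => c%:A) v F = F.
Proof.
move=> vN; rewrite [RHS]monalgE /psum_spec monalg.mmapE big_seq [RHS]big_seq.
apply: eq_bigr => m mF; set c := monalg.mcoeff m F.
have -> : \prod_(i <- finsupp m) v i.+1 ^+ m i =
    << \big[mmul/mone]_(i <- finsupp m) iter (m i) (mmul (@ucm nat i)) mone >>.
  rewrite [RHS](big_morph (fun m : {cmonom nat} => << m >> : symfun)
     (id1 := 1) (op1 := *%R)) //; last by move=> m1 m2; rewrite monalgUM.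
  rewrite big_seq [RHS]big_seq; apply: eq_bigr => i im; rewrite vN; last first.
    apply: leq_trans (leq_bigmax_seq (F := fun m : {cmonom nat} =>
      \max_(i <- finsupp m) i.+1) m mF isT).
    exact: (leq_bigmax_seq (F := succn) i im isT).
  rewrite [psum i.+1](erefl (<< @ucm nat i >> : symfun)).
  elim: (m i) => [|k IHk]; first exact: expr0.
  by rewrite exprS IHk; exact: monalgUM.
rewrite (_ : \big[_/_]_(i <- _) _ = m); last first.
  apply/eqP/cmP => j.
  rewrite (big_morph (fun m : {cmonom nat} => m j) (id1 := 0%N) (op1 := addn)); first last.
  - exact: cm1.
  - by move=> m1 m2; exact: cmM.
  have itE i k : iter k (mmul (@ucm nat i)) mone j = (k * (i == j))%N.
    by elim: k => [|k IHk] /=; rewrite ?cm1 // cmM IHk cmU mulSn.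
  under eq_bigr do rewrite itE.
  have [jm|] := boolP (j \in finsupp m).
    rewrite (bigD1_seq j) //= eqxx muln1 big1 ?addn0 // => i nij.
    by rewrite (negPf nij) muln0.
  rewrite -cmE_eq0 => mj; rewrite (eqP mj) big1 // => i _.
  by have [->|] := eqVneq i j; rewrite ?muln0 // (eqP mj).
by rewrite -scalerAl mul1r malgUZ.
Qed.

Fixpoint elem_seq (n : nat) : seq symfun :=
  if n is n'.+1 then
    let s := elem_seq n' in
    rcons s (n%:R^-1 *: \sum_(i < n) (-1) ^+ i * (nth 0 s (n' - i) * psum i.+1))
  else [:: 1].

(* e_r, obtained from the power sums by Newton's identities. *)
Definition elem (r : nat) : symfun := nth 0 (elem_seq r) r.

Lemma size_elem_seq n : size (elem_seq n) = n.+1.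
Proof. by elim: n => //= n IHn; rewrite size_rcons IHn. Qed.

Lemma nth_elem_seq n r : (r <= n)%N -> nth 0 (elem_seq n) r = elem r.
Proof.
elim: n => [|n IHn]; first by rewrite leqn0 => /eqP ->.
rewrite leq_eqVlt => /orP[/eqP -> //|ltrn].
by rewrite /= nth_rcons size_elem_seq ltrn IHn.
Qed.

Lemma elemS r : elem r.+1 =
  r.+1%:R^-1 *: \sum_(i < r.+1) (-1) ^+ i * (elem (r - i) * psum i.+1).
Proof.
have -> : \sum_(i < r.+1) (-1) ^+ i * (elem (r - i) * psum i.+1) =
    \sum_(i < r.+1) (-1) ^+ i * (nth 0 (elem_seq r) (r - i) * psum i.+1).
  by apply: eq_bigr => i _; rewrite nth_elem_seq // leq_subr.
by rewrite /elem /= nth_rcons size_elem_seq ltnn eqxx.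
Qed.

Lemma newton_elem n : newton_upto n elem psum.
Proof.
move=> r _; rewrite elemS mulr_natl -scaler_nat scalerA mulfV ?natr_char0_neq0 //.
by rewrite scale1r.
Qed.

Lemma elem0 : elem 0 = 1. Proof. by []. Qed.

End SymmetricFunctions.

Section SpecializationToVariables.
Variables (K : fieldType) (n : nat).

HB.instance Definition _ :=
  GRing.RMorphism.copy (@rf_const K n) (@FracField.tofrac _ \o @mpolyC n K).

HB.instance Definition _ := GRing.RMorphism.copy (@in_vars K n)
  (psum_spec (@rf_const K n) (fun r => \sum_(i < n) rf_var K i ^+ r)).

Lemma rf_var_inj : injective (@rf_var K n).
Proof.
move=> i j /eqP; rewrite tofrac_eq => /eqP/(congr1 (mcoeff U_(i)%MM)).
rewrite !mcoeffX eqxx; case: eqP => [/(congr1 (fun m : 'X_{1.. n} => m i))|_ /eqP].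
  by rewrite !mnm1E eqxx; case: eqP.
by rewrite oner_eq0.
Qed.

Lemma rf_var_neq0 (i : 'I_n) : rf_var K i != 0.
Proof.
rewrite tofrac_eq0; apply/eqP => /(congr1 (mcoeff U_(i)%MM))/eqP.
by rewrite mcoeffX eqxx mcoeff0 oner_eq0.
Qed.

Lemma in_vars_psum r : in_vars n (psum K r.+1) = \sum_(i < n) rf_var K i ^+ r.+1.
Proof. exact: psum_spec_psum. Qed.

Lemma in_varsZ c (F : symfun K) : in_vars n (c *: F) = rf_const n c * in_vars n F.
Proof. exact: psum_specZ. Qed.

Hypothesis char0 : [pchar K] =i pred0.

Lemma ratfun_char0 : [pchar ratfun K n] =i pred0.
Proof.
apply/pcharf0P => k; rewrite -(rmorph_nat (@rf_const K n)) fmorph_eq0.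
by have/pcharf0P -> := char0.
Qed.

Lemma in_vars_elem r :
  in_vars n (elem K r) = (\prod_(i < n) (1 + rf_var K i *: 'X))`_r.
Proof.
pose p k := \sum_(i < n) rf_var K i ^+ k.
apply: (@newton_upto_elem _ (in_vars n \o elem K)
  (fun k => (\prod_(i < n) (1 + rf_var K i *: 'X))`_k) p r ratfun_char0) => //.
- rewrite /= rmorph1 coef_prod_linear (bigD1 finset.set0) ?cards0 //= big_set0 big1 ?addr0 //.
  by move=> A /andP[]; rewrite cards_eq0 => ->.
- move=> k ltkr; have := rmorph_newton_upto (@in_vars K n) (newton_elem char0 (n := r)) ltkr.
  move=> /= ->; apply: eq_bigr => i _; congr (_ * (_ * _)); exact: in_vars_psum.
have := @newton_prod _ [seq rf_var K i | i : 'I_n] r.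
move=> N k ltkr; have := N k ltkr; rewrite /= !big_image /= => ->.
by apply: eq_bigr => i _; rewrite !big_image.
Qed.

Local Notation mesyms := [tuple mesym n K i.+1 | i < n].

Lemma in_vars_mpoly (F : symfun K) :
  in_vars n F = FracField.tofrac (psum_spec (@mpolyC n K) (fun r => \sum_(i < n) 'X_i ^+ r) F).
Proof.
symmetry; rewrite (@rmorph_psum_spec K _ _ (@FracField.tofrac (mpoly n K)) (@mpolyC n K)
  (@rf_const K n) _ (fun r => \sum_(i < n) rf_var K i ^+ r)) // => r.
by rewrite rmorph_sum; apply: eq_bigr => i _; rewrite rmorphXn.
Qed.

Lemma psum_symmetric r : (\sum_(i < n) 'X_i ^+ r : mpoly n K) \is symmetric.
Proof.
apply/issymP => s; rewrite rmorph_sum [RHS](reindex_inj (@perm_inj _ s)).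
apply: eq_bigr => i _; rewrite rmorphXn; congr (_ ^+ _).
by rewrite /= /msym mmapX mmap1U.
Qed.

End SpecializationToVariables.

Section Faithfulness.
Variables (K : fieldType).
Hypothesis char0 : [pchar K] =i pred0.
Local Notation mesyms n := [tuple mesym n K i.+1 | i < n].

(* Power sums are polynomials [N r] in e_1, ..., e_n, which are algebraically
   independent in n variables; sending them back to the abstract e_1, ..., e_n
   recovers the abstract p_r for r <= n, by Newton's identities. *)
Lemma in_vars_inj0 (F : symfun K) m :
  (forall n, (m <= n)%N -> in_vars n F = 0) -> F = 0.
Proof.
move=> F0; pose N := \max_(k <- monalg.msupp F) \max_(i <- finsupp k) i.+1.
pose n := maxn m N; have {F0} := F0 n (leq_maxl _ _).
have leNn : (N <= n)%N := leq_maxr _ _.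
move: n leNn => n leNn.
rewrite in_vars_mpoly => /eqP; rewrite tofrac_eq0 => /eqP F0.
pose T r := sval (sym_fundamental (psum_symmetric K n r)).
have TP r : T r \mPo mesyms n = \sum_(i < n) 'X_i ^+ r.
  exact: (svalP (sym_fundamental (psum_symmetric K n r))).1.
have {}F0 : psum_spec (@mpolyC n K) T F = 0.
  apply: (@msym_fundamental_un0 n K); rewrite -[RHS]F0.
  apply: (rmorph_psum_spec (g := comp_mpoly (mesyms n))) => [c|r]; last exact: TP.
  exact: comp_mpolyC.
pose E i : mpoly n K := if i is j.+1 then oapp (fun k : 'I_n => 'X_k) 0 (insub j) else 1.
have EP i : (i <= n)%N -> E i \mPo mesyms n = mesym n K i.
  case: i => [|i] lein; first by rewrite mesym0E; exact: rmorph1.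
  by rewrite /E insubT /= comp_mpolyXU -tnth_nth tnth_mktuple.
have NE : newton_upto n E T.
  move=> r ltrn; apply: (@msym_fundamental_un n K).
  have cM p q : (p * q) \mPo mesyms n = (p \mPo mesyms n) * (q \mPo mesyms n).
    exact: (rmorphM (comp_mpoly (mesyms n))).
  have cN k : k%:R \mPo mesyms n = k%:R by exact: (rmorph_nat (comp_mpoly (mesyms n))).
  have cX k : (-1) ^+ k \mPo mesyms n = (-1) ^+ k.
    exact: (rmorph_sign (comp_mpoly (mesyms n))).
  have cS k (f : 'I_k -> mpoly n K) :
      (\sum_i f i) \mPo mesyms n = \sum_i (f i \mPo mesyms n).
    exact: (rmorph_sum (comp_mpoly (mesyms n))).
  have mesymE_coef k : mesym n K k = (\prod_(a <- [seq 'X_i | i : 'I_n]) (1 + a *: 'X))`_k.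
    by rewrite big_image /= coef_prod_linear.
  rewrite cM cN cS EP // mesymE_coef (@newton_prod _ [seq 'X_i | i : 'I_n] n r ltrn).
  apply: eq_bigr => i _; rewrite !cM cX EP; last by lia.
  by rewrite TP mesymE_coef [in LHS](big_image _ _ _ _ (fun a => a ^+ i.+1)).
pose eta := mpoly.mmap (GRing.in_alg (symfun K)) (fun i : 'I_n => elem K i.+1).
have etaE i : (i <= n)%N -> eta (E i) = elem K i.
  case: i => [|i] lein; first exact: rmorph1.
  by rewrite /E insubT /= /eta mmapX mmap1U.
have etaT r : (r < n)%N -> eta (T r.+1) = psum K r.+1.
  have NE' : newton_upto n (elem K) (eta \o T).
    exact: (eq_newton_upto etaE (rmorph_newton_upto eta NE)).
  exact: (newton_upto_psum (elem0 K) NE' (newton_elem char0 (n := n))).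
rewrite -[RHS](rmorph0 eta) -F0.
rewrite (@rmorph_psum_spec K _ _ eta (@mpolyC n K) (fun c => c%:A) _ (eta \o T)) //.
  by rewrite psum_spec_id // => r ltrN; apply: etaT; exact: leq_trans ltrN leNn.
by move=> c; exact: mmapC.
Qed.
End Faithfulness.

(** * Hall-Littlewood functions *)

Section Dominance.

Lemma leq_sumn_nth (s s' : seq nat) : (forall i, nth 0%N s i <= nth 0%N s' i)%N ->
  (sumn s <= sumn s')%N.
Proof.
elim: s s' => // a s IHs [|b s'] les.
  have /= := les 0%N; rewrite leqn0 => /eqP ->.
  by apply: (IHs [::]) => i; have := les i.+1; rewrite !nth_nil.
by apply: leq_add; [exact: (les 0%N) | apply: IHs => i; exact: (les i.+1)].
Qed.

Lemma eq_sumn_nth (s s' : seq nat) : (forall i, nth 0%N s i <= nth 0%N s' i)%N ->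
  sumn s = sumn s' -> forall i, nth 0%N s i = nth 0%N s' i.
Proof.
elim: s s' => [|a s IHs] [|b s'] //= les eqs i.
- have := leq_sumn (s := b :: s') (i := nth 0%N (b :: s') i).
  have [lti|] := ltnP i (size (b :: s')); last by move=> lei _; rewrite nth_nil nth_default.
  by rewrite mem_nth // /= -eqs leqn0 => /(_ isT) /eqP ->; rewrite nth_nil.
- by apply/eqP; have := les i; rewrite !nth_nil leqn0.
have leab : (a <= b)%N := les 0%N.
have les' j : (nth 0%N s j <= nth 0%N s' j)%N := les j.+1.
have := leq_sumn_nth les' => lesum.
have eqab : a = b by lia.
case: i => [|i] //=; apply: IHs => //; lia.
Qed.

Lemma intpart_eq_nth (c d : intpart) : (forall i, nth 0%N c i = nth 0%N d i) -> c = d.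
Proof.
move=> eqn; pose N := maxn (size c) (size d).
rewrite -(@mkpart_pad N c) ?leq_maxl // -(@mkpart_pad N d) ?leq_maxr //.
by congr mkpart; apply: eq_map.
Qed.

Definition tailp (c : intpart) : intpart := mkpart (behead c).

Lemma tailpE (c : intpart) : tailp c = behead c :> seq nat.
Proof.
have := intpart_sorted c; have := intpart_gt0 c; rewrite /tailp.
case: (parts c) => [|a s] pos srt //; rewrite mkpartE; last exact: path_sorted srt.
by apply/all_filterP; case/andP: pos.
Qed.

Lemma sumn_tailp (c : intpart) : sumn c = (head 0%N c + sumn (tailp c))%N.
Proof. by rewrite tailpE; case: (parts c). Qed.

Lemma head_tailp (c : intpart) : (head 0%N (tailp c) <= head 0%N c)%N.
Proof.
rewrite tailpE; have := intpart_sorted c.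
by case: (parts c) => // a [|b s] //= /andP[].
Qed.

Lemma conj_ind (P : intpart -> Prop) :
  P (mkpart [::]) ->
  (forall c : intpart, (0 < head 0%N c)%N -> P (tailp c) ->
     (forall k : intpart, sumn k = sumn c -> (head 0 c < head 0 k)%N -> P k) -> P c) ->
  forall c, P c.
Proof.
move=> P0 IP c; move: {-1}(sumn c) (erefl (sumn c)) => D; elim/ltn_ind: D c => D IHD c.
move: {-1}(D - head 0 c)%N (leqnn (D - head 0 c)%N) => k; elim: k c => [|k IHk] c lek sumc.
  have [c0|cp] := posnP (head 0%N c).
    suff -> : c = mkpart [::] by [].
    apply: intpart_inj; have := intpart_gt0 c; rewrite /=.
    by case: (parts c) c0 => //= a s -> .
  apply: IP => // [|k sumk ltk].
    by apply: (IHD (sumn (tailp c))) => //; have := sumn_tailp c; lia.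
  have := sumn_tailp k; lia.
have [c0|cp] := posnP (head 0%N c).
  suff -> : c = mkpart [::] by [].
  apply: intpart_inj; have := intpart_gt0 c; rewrite /=.
  by case: (parts c) c0 => //= a s -> .
apply: IP => // [|k' sumk ltk].
  by apply: (IHD (sumn (tailp c))) => //; have := sumn_tailp c; lia.
apply: IHk; rewrite ?sumk //; have := sumn_tailp k'; lia.
Qed.

Variables (K : fieldType) (t : K).
Hypothesis t_generic : forall r : nat, (0 < r)%N -> t ^+ r != 1.

Lemma pieri_neq0_nth c d i : pieri t c d != 0 ->
  (nth 0 c i.+1 <= nth 0 d i)%N /\ (nth 0 d i <= nth 0 c i)%N.
Proof.
elim: c d i => [|c1 c IHc] d i /=.
  case: (boolP (all _ d)) => [d0 _|_]; last by rewrite eqxx.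
  rewrite nth_nil; split=> //; rewrite leqn0.
  have [lti|lei] := ltnP i (size d); last by rewrite nth_default.
  by move: (allP d0 _ (mem_nth 0%N lti)).
case: ifP => [/andP[lec led]|_]; last by rewrite mul0r eqxx.
rewrite mulf_eq0 negb_or => /andP[_ /IHc IH].
case: i => [|i]; first by rewrite !nth0.
by rewrite -!(nth_behead 0%N d); exact: IH.
Qed.

Lemma pieri_behead c : sorted geq c -> pieri t c (behead c) = 1.
Proof.
elim: c => [|c1 c IHc] //= srt; rewrite IHc ?(path_sorted srt) // leqnn gbinn // mulr1.
by case: c srt {IHc} => //= c2 c /andP[->].
Qed.

Lemma pieri_tailp (k c : intpart) : sumn k = sumn c -> pieri t k (tailp c) != 0 ->
  k != c -> (head 0 c < head 0 k)%N.
Proof.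
move=> sumk nz; apply: contraNltn => lek; apply/eqP/intpart_eq_nth.
apply: eq_sumn_nth => // -[|i]; first by rewrite !nth0.
by rewrite -(nth_behead 0%N c) -tailpE; have [] := pieri_neq0_nth i nz.
Qed.

Lemma big_pieri_tailp (V : nmodType) (c : intpart) (G : K -> intpart -> V) :
    (forall k, G 0 k = 0) ->
  \sum_(k <- partitions (sumn c)) G (pieri t k (tailp c)) k =
  G 1 c + \sum_(k <- partitions (sumn c) | (head 0 c < head 0 k)%N)
    G (pieri t k (tailp c)) k.
Proof.
move=> G0; rewrite (bigD1_seq c) ?partitions_uniq ?mem_partitions //.
rewrite {1}tailpE pieri_behead ?intpart_sorted //; congr (_ + _).
rewrite [RHS]big_mkcond [LHS]big_mkcond big_seq [RHS]big_seq; apply: eq_bigr => k.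
rewrite mem_partitions => /eqP sumk.
have [->|nz] := eqVneq (pieri t k (tailp c)) 0; first by rewrite G0 !if_same.
have [->|nk] := eqVneq k c; first by rewrite ltnn.
by rewrite (pieri_tailp sumk nz nk).
Qed.

End Dominance.

Section HallLittlewoodExistence.
Variables (K : fieldType) (t : K).
Hypothesis char0 : [pchar K] =i pred0.
Hypothesis t_generic : forall r : nat, (0 < r)%N -> t ^+ r != 1.

Lemma count_iota_between n a b : (a <= n)%N ->
  count (fun j => (b <= j < a)%N) (iota 0 n) = (a - b)%N.
Proof.
move=> lean; have -> : (a - b = minn n a - b)%N by lia.
elim: n {lean} => [|n IHn]; first by rewrite min0n.
by rewrite -addn1 iotaD count_cat IHn /= !add0n addn0; case: (ltnP n a); case: (leqP b n); lia.
Qed.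

Lemma card_conj_mult n (c : intpart) i : (head 0 c <= n)%N ->
  #|[pred j : 'I_n | nth 0%N (conjp c) j == i]| =
  (nth 0%N (n :: c) i - nth 0%N (n :: c) i.+1)%N.
Proof.
move=> len; have srt := intpart_sorted c.
have lea : (nth 0%N (n :: c) i <= n)%N.
  case: i => //= i; apply: leq_trans len; have [lti|lei] := ltnP i (size c).
    by rewrite leq_head // mem_nth.
  by rewrite nth_default.
rewrite -(count_iota_between _ lea) -sum1_card big_mkcond /=.
pose P j := (nth 0 (n :: c) i.+1 <= j < nth 0 (n :: c) i)%N.
rewrite (eq_bigr (fun j : 'I_n => if P j then 1%N else 0%N)) => [|j _].
  rewrite -(big_mkord xpredT (fun j => if P j then 1%N else 0%N)) -big_mkcond /=.
  by rewrite sum1_count /index_iota subn0.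
rewrite inE nth_conjp // /P; congr (if _ then _ else _).
rewrite eqn_leq leqNgt count_gt_sorted // -leqNgt; congr (_ && _).
by case: (i) => [|i'] //=; rewrite ?ltn_ord // count_gt_sorted.
Qed.

Lemma hl_v_conjp n (c : intpart) : (head 0 c <= n)%N ->
  hl_v t n (conjp c) = hl_norm t n c.
Proof.
move=> len; have srt := intpart_sorted c.
have -> : hl_v t n (conjp c) =
    \prod_(0 <= i < (size c).+1) hl_v1 t (nth 0%N (n :: c) i - nth 0%N (n :: c) i.+1).
  rewrite /hl_v -nth0 nth_conjp //; have -> : count (fun v => 0 < v)%N c = size c.
    by rewrite -[RHS]count_predT; apply: eq_in_count => v /(allP (intpart_gt0 c)).
  by apply: eq_bigr => i _; rewrite card_conj_mult.
elim: (parts c) n {len srt} => [|a s IHs] n.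
  by rewrite big_nat1 /= subn0.
by rewrite big_nat_recl //= IHs.
Qed.

Lemma hl_norm_zeros n s k : hl_norm t n (s ++ nseq k 0%N) = hl_norm t n s.
Proof.
elim: s n => [|a s IHs] n /=; last by rewrite IHs.
elim: k n => [|k IHk] n //=.
by rewrite subn0 IHk /= {2}/hl_v1 big_geq ?mulr1.
Qed.

Lemma conj_word_zeros n s k : conj_word n (s ++ nseq k 0%N) = conj_word n s.
Proof.
by apply: eq_map => i; rewrite count_cat [X in (_ + X)%N](_ : _ = 0%N) ?addn0 //; elim: (k).
Qed.

Lemma hl_vars_mkpart (F : fieldType) (phi : {rmorphism K -> F}) n (x : 'I_n -> F) s :
  sorted geq s -> hl_vars t phi x (mkpart s) = hl_vars t phi x s.
Proof.
by move=> srt; rewrite [in RHS](sorted_mkpart srt) /hl_vars hl_norm_zeros conj_word_zeros.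
Qed.

(* P_la in n variables, for c conjugate to la; it is 0 if la has more than n parts. *)
Definition hl_Pn n (c : seq nat) : ratfun K n :=
  if (head 0 c <= n)%N then hl_vars t (@rf_const K n) (@rf_var K n) c else 0.

Lemma hl_P_varsE n (c : intpart) : (head 0 c <= n)%N ->
  hl_P_vars t n (conjp c) = hl_Pn n c.
Proof.
move=> len; rewrite /hl_Pn len /hl_P_vars /hl_vars hl_v_conjp // -fmorphV.
congr (_ * _); rewrite /hl_word size_conj_word eqxx; apply: eq_bigr => w _.
rewrite /hl_term; congr (_ * _); apply: eq_bigr => i _.
by rewrite nth_conjp ?intpart_sorted // nth_mkseq.
Qed.

Lemma pieri_Pn n r (d : intpart) : (head 0 d <= n)%N ->
  in_vars n (elem K r) * hl_Pn n d =
  \sum_(c <- partitions (sumn d + r)) rf_const n (pieri t c d) * hl_Pn n c.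
Proof.
move=> len; rewrite in_vars_elem // {1}/hl_Pn len.
rewrite pieri_vars ?intpart_sorted //; last 2 first.
- by have/pcharf0P -> := ratfun_char0 n char0.
- exact: rf_var_inj.
rewrite [RHS](bigID (fun c : intpart => (head 0 c <= n)%N)) /= [X in _ = _ + X]big1 ?addr0; last first.
  by move=> c /negPf nc; rewrite /hl_Pn nc mulr0.
rewrite -(big_interlacing t_generic (G := fun p c => rf_const n p * hl_Pn n c)); last first.
  by move=> c; rewrite rmorph0 mul0r.
rewrite big_seq_cond [RHS]big_seq_cond; apply: eq_bigr => c /andP[cP _].
have [_ lec _ _ srt] := interlacingP cP.
by rewrite /hl_Pn head_mkpart // lec; congr (_ * _); rewrite hl_vars_mkpart.
Qed.

Lemma elem_small n r : (n < r)%N -> in_vars n (elem K r) = 0.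
Proof.
move=> ltnr; rewrite in_vars_elem // coef_prod_linear big1 // => A /eqP cardA.
by have := max_card A; rewrite cardA card_ord leqNgt ltnr.
Qed.

Lemma hl_Pn_nil n : hl_Pn n (mkpart [::]) = 1.
Proof.
rewrite /hl_Pn (_ : mkpart [::] = [::] :> seq nat) // /hl_vars /= /hl_word.
rewrite size_conj_word eqxx conj_word_nil.
have -> : hl_sum (rf_const n t) (@rf_var K n) (nth 0%N (nseq n 0%N)) =
    hl_sum (rf_const n t) (@rf_var K n) (fun=> 0%N).
  by apply: eq_bigr => w _; congr (_ * _); apply: eq_bigr => i _; rewrite nth_nseq if_same.
rewrite hl_sum0; first last.
- exact: rf_var_neq0.
- exact: rf_var_inj.
- rewrite -(rmorph1 (@rf_const K n)) (inj_eq (fmorph_inj _)).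
  exact: (t_generic (r := 1)).
have -> : hl_v1 (rf_const n t) n = rf_const n (hl_v1 t n).
  rewrite /hl_v1 rmorph_prod; apply: eq_bigr => i _.
  by rewrite fmorph_div !rmorphB rmorphXn rmorph1.
by rewrite mulVf // fmorph_eq0 hl_v1_neq0.
Qed.

(* Induction on the conjugate partition: e_(c_1) P_(c_2, c_3, ...) is P_c plus
   terms P_k with k_1 > c_1. *)
Lemma hl_P_exists (c : intpart) : exists F : symfun K, forall n, in_vars n F = hl_Pn n c.
Proof.
elim/conj_ind: c => [|c cp [F0 F0P] Fk].
  by exists 1 => n; rewrite hl_Pn_nil rmorph1.
have /boolp.choice[F FP] : forall k : intpart, exists F : symfun K,
    sumn k = sumn c -> (head 0 c < head 0 k)%N -> forall n, in_vars n F = hl_Pn n k.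
  move=> k; have [sumk|nk] := eqVneq (sumn k) (sumn c); last first.
    by exists 0 => eqk; rewrite eqk eqxx in nk.
  have [ltk|lek] := ltnP (head 0%N c) (head 0%N k); last by exists 0.
  by have [F FP] := Fk k sumk ltk; exists F.
exists (elem K (head 0%N c) * F0 -
  \sum_(k <- partitions (sumn c) | (head 0 c < head 0 k)%N) pieri t k (tailp c) *: F k) => n.
rewrite rmorphB rmorphM rmorph_sum /= F0P.
rewrite big_seq_cond (eq_bigr (fun k : intpart =>
  rf_const n (pieri t k (tailp c)) * hl_Pn n k)); last first.
  by move=> k /andP[]; rewrite mem_partitions in_varsZ => /eqP sumk ltk; rewrite FP.
rewrite -big_seq_cond.
have [len|ltn] := leqP (head 0%N c) n; last first.
  rewrite /hl_Pn elem_small // mul0r sub0r leqNgt ltn /= big1 ?oppr0 // => k ltk.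
  by rewrite leqNgt (ltn_trans ltn ltk) mulr0.
rewrite pieri_Pn; last exact: leq_trans (head_tailp c) len.
rewrite addnC -sumn_tailp.
rewrite (@big_pieri_tailp _ _ t_generic _ c (fun p k => rf_const n p * hl_Pn n k)).
  by rewrite rmorph1 mul1r addrK.
by move=> k; rewrite rmorph0 mul0r.
Qed.

(* P_la as a symmetric function, for c conjugate to la. *)
Definition hl_Pc (c : seq nat) : symfun K := hl_P t (conjp c).

Lemma in_vars_hl_Pc n (c : intpart) : in_vars n (hl_Pc c) = hl_Pn n c.
Proof.
have [F FP] := hl_P_exists c.
suff -> : hl_Pc c = F by [].
apply/eqP; rewrite -subr_eq0; apply/eqP.
apply: (in_vars_inj0 char0 (m := head 0%N c)) => k lek.
rewrite rmorphB /= FP -(hl_P_varsE lek); apply/eqP; rewrite subr_eq0; apply/eqP.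
rewrite /hl_Pc /hl_P; case: xgetP => [G -> /(_ k)|/(_ F) []].
  by apply; rewrite size_conjp ?intpart_sorted.
by move=> l; rewrite size_conjp ?intpart_sorted // => lel; rewrite FP hl_P_varsE.
Qed.

Lemma elem_hl_Pc r (d : intpart) :
  elem K r * hl_Pc d =
  \sum_(c <- partitions (sumn d + r)) pieri t c d *: hl_Pc c.
Proof.
apply/eqP; rewrite -subr_eq0; apply/eqP.
apply: (in_vars_inj0 char0 (m := head 0%N d)) => n len.
rewrite rmorphB rmorphM rmorph_sum /= in_vars_hl_Pc pieri_Pn //.
apply/eqP; rewrite subr_eq0; apply/eqP; apply: eq_bigr => c _.
by rewrite in_varsZ in_vars_hl_Pc.
Qed.

Lemma hl_Pc_nil : hl_Pc (mkpart [::]) = 1.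
Proof.
apply/eqP; rewrite -subr_eq0; apply/eqP.
apply: (in_vars_inj0 char0 (m := 0%N)) => n _.
by rewrite rmorphB rmorph1 [X in X - _]in_vars_hl_Pc hl_Pn_nil subrr.
Qed.

Lemma hl_Pc_rec (c : intpart) :
  hl_Pc c = elem K (head 0%N c) * hl_Pc (tailp c) -
    \sum_(k <- partitions (sumn c) | (head 0 c < head 0 k)%N)
       pieri t k (tailp c) *: hl_Pc k.
Proof.
rewrite elem_hl_Pc addnC -sumn_tailp.
rewrite (@big_pieri_tailp _ _ t_generic _ c (fun p k => p *: hl_Pc k)).
  by rewrite scale1r addrK.
by move=> k; rewrite scale0r.
Qed.

End HallLittlewoodExistence.

(* Counting: A B = 1 since p is free, hence B A = 1. *)
Lemma free_of_spanning (K : fieldType) (V : lmodType K) N (p P : 'I_N -> V)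
    (A B : 'M[K]_N) :
    (forall x : 'I_N -> K, \sum_i x i *: p i = 0 -> forall i, x i = 0) ->
    (forall i, p i = \sum_j A i j *: P j) -> (forall i, P i = \sum_j B i j *: p j) ->
  forall x : 'I_N -> K, \sum_i x i *: P i = 0 -> forall i, x i = 0.
Proof.
move=> free_p pA PB x x0.
have AB : A *m B = 1%:M.
  apply/matrixP => i k; apply/eqP; rewrite -subr_eq0; apply/eqP; move: k.
  apply: (free_p (fun k => (A *m B) i k - 1%:M i k)).
  under eq_bigr do rewrite scalerBl.
  rewrite sumrB [X in _ - X](bigD1 i) //= [X in _ - (_ + X)]big1 => [|k nk]; last first.
    by rewrite !mxE eq_sym (negPf nk) scale0r.
  rewrite !mxE eqxx scale1r addr0 pA; apply/eqP; rewrite subr_eq0; apply/eqP.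
  under eq_bigr do rewrite mxE scaler_suml.
  rewrite exchange_big /=; apply: eq_bigr => j _; rewrite PB scaler_sumr.
  by apply: eq_bigr => k _; rewrite scalerA.
pose X : 'rV_N := \row_i x i.
have XB : X *m B = 0.
  suff h k : (X *m B) 0 k = 0 by apply/rowP => k; rewrite h mxE.
  move: k; apply: (free_p (fun k => (X *m B) 0 k)).
  rewrite -[RHS]x0; under eq_bigr do rewrite mxE scaler_suml.
  rewrite exchange_big /=; apply: eq_bigr => j _; rewrite PB scaler_sumr.
  by apply: eq_bigr => k _; rewrite mxE scalerA.
have X0 : X = 0 by rewrite -[X]mulmx1 -(mulmx1C AB) mulmxA XB mul0mx.
by move=> i; have := congr1 (fun Y : 'rV_N => Y 0 i) X0; rewrite !mxE.
Qed.

Section GradedSpans.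
Variables (K : fieldType) (V : lmodType K) (B : intpart -> V).

Definition in_span (n : nat) (F : V) :=
  exists x : intpart -> K, F = \sum_(c <- partitions n) x c *: B c.

Lemma in_span_basis (c : intpart) : in_span (sumn c) (B c).
Proof.
exists (fun k => (k == c)%:R); rewrite (bigD1_seq c) ?partitions_uniq ?mem_partitions //=.
by rewrite eqxx scale1r big1 ?addr0 // => k /negPf ->; rewrite scale0r.
Qed.

Lemma in_span0 n : in_span n 0.
Proof. by exists (fun=> 0); rewrite big1 // => c _; rewrite scale0r. Qed.

Lemma in_spanD n F G : in_span n F -> in_span n G -> in_span n (F + G).
Proof.
move=> [x ->] [y ->]; exists (fun c => x c + y c); rewrite -big_split.
by apply: eq_bigr => c _; rewrite scalerDl.
Qed.

Lemma in_spanZ n a F : in_span n F -> in_span n (a *: F).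
Proof.
move=> [x ->]; exists (fun c => a * x c); rewrite scaler_sumr.
by apply: eq_bigr => c _; rewrite scalerA.
Qed.

Lemma in_spanB n F G : in_span n F -> in_span n G -> in_span n (F - G).
Proof. by move=> sF sG; rewrite -scaleN1r; apply: in_spanD => //; exact: in_spanZ. Qed.

Lemma in_span_sum (I : eqType) (r : seq I) (P : pred I) n (F : I -> V) :
  (forall i, i \in r -> P i -> in_span n (F i)) -> in_span n (\sum_(i <- r | P i) F i).
Proof.
move=> sF; rewrite big_seq_cond; apply: (big_rec (in_span n)); first exact: in_span0.
by move=> i G /andP[ir Pi]; apply: in_spanD; exact: sF.
Qed.

End GradedSpans.

Section HallLittlewoodBasis.
Variables (K : fieldType) (t : K).
Hypothesis char0 : [pchar K] =i pred0.
Hypothesis t_generic : forall r : nat, (0 < r)%N -> t ^+ r != 1.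

Definition psump (s : seq nat) : symfun K := \prod_(i <- s) psum K i.

Local Notation pspan := (in_span psump).
Local Notation hspan := (in_span (fun c : intpart => hl_Pc t c)).

Lemma psump_mkpart s : all (leq 1) s -> psump (mkpart s) = psump s.
Proof.
move=> /all_filterP pos; apply: perm_big.
by rewrite /mkpart /= pos perm_sort.
Qed.

Lemma pspanM m n F G : pspan m F -> pspan n G -> pspan (m + n) (F * G).
Proof.
move=> [x ->] [y ->]; rewrite mulr_suml; apply: in_span_sum => c.
rewrite mem_partitions => /eqP <- _; rewrite mulr_sumr; apply: in_span_sum => d.
rewrite mem_partitions => /eqP <- _; rewrite -scalerAl -scalerAr; do 2!apply: in_spanZ.
rewrite -sumn_cat -(sumn_mkpart (c ++ d)) /psump -big_cat.
rewrite -[X in in_span _ _ X](psump_mkpart (s := c ++ d)); last first.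
  by rewrite all_cat !intpart_gt0.
exact: (in_span_basis (fun c : intpart => psump c)).
Qed.

Lemma pspan_psum r : pspan r.+1 (psum K r.+1).
Proof.
have -> : psum K r.+1 = psump (mkpart [:: r.+1]) by rewrite /psump big_seq1.
have := in_span_basis (fun c : intpart => psump c) (mkpart [:: r.+1]).
by rewrite sumn_mkpart /= addn0.
Qed.

Lemma signZ i (F : symfun K) : (-1) ^+ i * F = ((-1) ^+ i : K) *: F.
Proof. by rewrite -signr_odd -[in RHS]signr_odd mulr_sign scaler_sign. Qed.

Lemma pspan_elem r : pspan r (elem K r).
Proof.
elim/ltn_ind: r => -[_|r IHr].
  have := in_span_basis (fun c : intpart => psump c) (mkpart [::]).
  by rewrite sumn_mkpart /psump big_nil.
rewrite elemS; apply: in_spanZ; apply: in_span_sum => i _ _; rewrite signZ; apply: in_spanZ.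
have e : ((r - i) + i.+1 = r.+1)%N by have := ltn_ord i; lia.
rewrite -[X in in_span _ X _]e.
by apply: pspanM; [apply: IHr; lia | exact: pspan_psum].
Qed.

Lemma pspan_hl_Pc (c : intpart) : pspan (sumn c) (hl_Pc t c).
Proof.
elim/conj_ind: c => [|c cp Ft Fk].
  rewrite hl_Pc_nil //; exact: pspan_elem 0.
rewrite hl_Pc_rec //; apply: in_spanB.
  by rewrite sumn_tailp; apply: pspanM => //; exact: pspan_elem.
apply: in_span_sum => k; rewrite mem_partitions => /eqP sumk ltk; apply: in_spanZ.
by rewrite -sumk; exact: Fk.
Qed.

Lemma hspan_elemM r n F : hspan n F -> hspan (n + r) (elem K r * F).
Proof.
move=> [x ->]; rewrite mulr_sumr; apply: in_span_sum => c.
rewrite mem_partitions => /eqP <- _; rewrite -scalerAr; apply: in_spanZ.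
by exists (fun k : intpart => pieri t k c); exact: elem_hl_Pc.
Qed.

Lemma hspan_psumM r n F : hspan n F -> hspan (n + r.+1) (psum K r.+1 * F).
Proof.
elim/ltn_ind: r n F => r IHr n F sF.
rewrite (newton_psum (elem0 K) (newton_elem char0 (n := r.+1)) (ltnSn r)).
rewrite signZ -scalerAl mulrBl; apply: in_spanZ; apply: in_spanB.
  rewrite -mulrA mulr_natl -scaler_nat; apply: in_spanZ; exact: hspan_elemM.
rewrite mulr_suml; apply: in_span_sum => i _ _; rewrite signZ -scalerAl -mulrA.
apply: in_spanZ.
have e : ((n + i.+1) + (r - i) = n + r.+1)%N by have := ltn_ord i; lia.
rewrite -[X in in_span _ X _]e.
by apply: hspan_elemM; apply: IHr.
Qed.

Lemma hspan_psumpM s n F : all (leq 1) s -> hspan n F -> hspan (n + sumn s) (psump s * F).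
Proof.
elim: s n F => [|[|a] s IHs] n F //= pos sF; rewrite /psump.
  by rewrite big_nil mul1r addn0.
rewrite big_cons -mulrA (_ : n + (a.+1 + sumn s) = (n + sumn s) + a.+1)%N; last by lia.
by apply: hspan_psumM; exact: IHs.
Qed.

Lemma pspan_hspanM m n F G : pspan m F -> hspan n G -> hspan (n + m) (F * G).
Proof.
move=> [x ->] sG; rewrite mulr_suml; apply: in_span_sum => c.
rewrite mem_partitions => /eqP <- _; rewrite -scalerAl; apply: in_spanZ.
by apply: hspan_psumpM => //; exact: intpart_gt0.
Qed.

Lemma psump_hspan (c : intpart) : hspan (sumn c) (psump c).
Proof.
rewrite -[X in in_span _ _ X]mulr1 -(hl_Pc_nil char0 t_generic) -[sumn c]add0n.
apply: hspan_psumpM; first exact: intpart_gt0.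
have := in_span_basis (fun c : intpart => hl_Pc t c) (mkpart [::]).
by rewrite sumn_mkpart.
Qed.

Definition psum_mon (s : seq nat) : {cmonom nat} :=
  \big[mmul/mone]_(i <- s) @ucm nat i.-1.

Lemma psumpE s : psump s = << psum_mon s >>.
Proof.
rewrite /psump /psum_mon.
elim: s => [|i s IHs]; first by rewrite !big_nil.
by rewrite !big_cons IHs; exact: monalgUM.
Qed.

Lemma psum_mon_inj : injective (fun c : intpart => psum_mon c).
Proof.
move=> c d /= eqcd; rewrite -(mkpartK c) -(mkpartK d); apply: mkpart_perm.
have monE (e : intpart) j : psum_mon e j = count_mem j.+1 e.
  rewrite /psum_mon; elim: (parts e) (intpart_gt0 e) => [|a s IHs] /=.
    by rewrite big_nil cm1.
  case: a => // a pos; rewrite big_cons cmM cmU IHs //.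
apply/allP => j _ /=; case: j => [|j]; last by rewrite -!monE eqcd.
have z (e : intpart) : count_mem 0%N e = 0%N.
  by apply/count_memPn; apply/negP => /(allP (intpart_gt0 e)).
by rewrite !z.
Qed.

Lemma psump_free (L : seq intpart) (x : intpart -> K) : uniq L ->
  \sum_(c <- L) x c *: psump c = 0 -> forall c, c \in L -> x c = 0.
Proof.
move=> uL x0 c cL.
have := congr1 (monalg.mcoeff (psum_mon c)) x0; rewrite monalg.mcoeff0 raddf_sum /=.
rewrite (bigD1_seq c) //= big1 => [|d nd].
  by rewrite addr0 psumpE malgUZ monalg.mcoeffU eqxx.
by rewrite psumpE malgUZ monalg.mcoeffU (inj_eq psum_mon_inj) (negPf nd).
Qed.

Lemma in_span_upto (B : intpart -> symfun K) n (c : intpart) F : (sumn c <= n)%N ->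
  in_span B (sumn c) F ->
  exists x : 'I_(size (partitions_upto n)) -> K,
    F = \sum_i x i *: B (tnth (in_tuple (partitions_upto n)) i).
Proof.
move=> lec [x ->].
exists (fun i => if sumn (tnth (in_tuple (partitions_upto n)) i) == sumn c
   then x (tnth (in_tuple (partitions_upto n)) i) else 0).
rewrite -(big_tnth _ _ (partitions_upto n) xpredT
  (fun d => (if sumn d == sumn c then x d else 0) *: B d)).
rewrite (big_partitions_sub _ lec); apply: eq_bigr => d _.
by case: ifP => // _; rewrite scale0r.
Qed.

Lemma hl_Pc_free n (x : intpart -> K) :
  \sum_(c <- partitions_upto n) x c *: hl_Pc t c = 0 ->
  forall c : intpart, (sumn c <= n)%N -> x c = 0.
Proof.
pose L := in_tuple (partitions_upto n).
move=> x0 c lec; have cL : c \in partitions_upto n by rewrite mem_partitions_upto.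
have leL i : (sumn (tnth L i) <= n)%N by rewrite -mem_partitions_upto mem_tnth.
have /boolp.choice[A pA] i := in_span_upto (leL i) (psump_hspan (tnth L i)).
have /boolp.choice[B PB] i := in_span_upto (leL i) (pspan_hl_Pc (tnth L i)).
have free_p (y : 'I_(size (partitions_upto n)) -> K) :
    \sum_i y i *: psump (tnth L i) = 0 -> forall i, y i = 0.
  move=> y0 i.
  pose y' d := if insub (index d (partitions_upto n)) is Some j then y j else 0.
  have y'E j : y' (tnth L j) = y j.
    rewrite /y' (tnth_nth (mkpart [::])) index_uniq ?partitions_upto_uniq //.
    by rewrite valK.
  rewrite -y'E; apply: (psump_free (partitions_upto_uniq n)) (mem_tnth i L).
  rewrite big_tnth -[RHS]y0; apply: eq_bigr => j _.
  by rewrite y'E.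
have := @free_of_spanning K _ _ (fun i => psump (tnth L i)) (fun i => hl_Pc t (tnth L i))
  (\matrix_(i, j) A i j) (\matrix_(i, j) B i j) free_p.
move=> H.
have {}H := H _ _ (fun i => x (tnth L i)).
rewrite -[c](nth_index (mkpart [::]) cL).
have ltc : (index c (partitions_upto n) < size (partitions_upto n))%N by rewrite index_mem.
have := H _ _ _ (Ordinal ltc); rewrite (tnth_nth (mkpart [::])); apply.
- by move=> i; rewrite pA; apply: eq_bigr => j _; rewrite mxE.
- by move=> i; rewrite PB; apply: eq_bigr => j _; rewrite mxE.
- by rewrite -[RHS]x0 [RHS]big_tnth.
Qed.

End HallLittlewoodBasis.

Section StructureConstants.
Variables (K : fieldType) (t : K).
Hypothesis char0 : [pchar K] =i pred0.
Hypothesis t_generic : forall r : nat, (0 < r)%N -> t ^+ r != 1.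

Lemma hl_Pc_coef n (x y : intpart -> K) :
  \sum_(c <- partitions n) x c *: hl_Pc t c = \sum_(c <- partitions n) y c *: hl_Pc t c ->
  forall c : intpart, sumn c = n -> x c = y c.
Proof.
move=> eqxy c sumc; apply/eqP; rewrite -subr_eq0; apply/eqP.
pose z (d : intpart) := if sumn d == n then x d - y d else 0.
suff /(_ c) : forall k : intpart, (sumn k <= n)%N -> z k = 0.
  by rewrite /z sumc leqnn eqxx => /(_ isT).
apply: (hl_Pc_free char0 t_generic).
transitivity (\sum_(d <- partitions n) (x d - y d) *: hl_Pc t d).
  rewrite (big_partitions_sub _ (leqnn n)); apply: eq_bigr => d _.
  by rewrite /z; case: ifP => [//|_]; rewrite scale0r.
under eq_bigr do rewrite scalerBl.
by rewrite sumrB; apply/eqP; rewrite subr_eq0; apply/eqP; exact: eqxy.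
Qed.

Lemma big_msupp_sub (g : {malg K[intpart]}) (L : seq intpart) (B : intpart -> symfun K) :
  uniq L -> {subset monalg.msupp g <= L} ->
  \sum_(c <- monalg.msupp g) monalg.mcoeff c g *: B c =
  \sum_(c <- L) monalg.mcoeff c g *: B c.
Proof.
move=> uL sL; rewrite [RHS](bigID (fun c => c \in monalg.msupp g)) /=.
rewrite [X in _ = _ + X]big1 ?addr0 => [|c nc]; last first.
  by rewrite monalg.mcoeff_outdom // scale0r.
rewrite -[RHS]big_filter; apply: perm_big; apply: uniq_perm => [||c].
- exact: fset_uniq.
- by rewrite filter_uniq.
by rewrite mem_filter; case: (boolP (c \in monalg.msupp g)) => // /sL ->.
Qed.

Lemma hl_f_coef (d e : intpart) (y : intpart -> K) (n := (sumn d + sumn e)%N) :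
    hl_Pc t d * hl_Pc t e = \sum_(c <- partitions n) y c *: hl_Pc t c ->
  forall c : intpart,
  hl_f t (conjp c) (conjp d) (conjp e) = if sumn c == n then y c else 0.
Proof.
move=> yP c; rewrite /hl_f.
have uL m : uniq [seq conjp (k : intpart) | k <- partitions_upto m].
  by rewrite map_inj_uniq ?partitions_upto_uniq // => k l /conjp_inj.
have : hl_P t (conjp d) * hl_P t (conjp e) =
   \sum_(la <- monalg.msupp (hl_expansion t (conjp d) (conjp e)))
      monalg.mcoeff la (hl_expansion t (conjp d) (conjp e)) *: hl_P t la.
  pose g : {malg K[intpart]} := \sum_(k <- partitions n) << y k *g conjp k >>.
  rewrite /hl_expansion; set A := (X in xget 0 X); suff : A (xget 0 A) by [].
  apply: (@xgetPex _ 0 A); exists g; rewrite /A /=.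
  have gE (k : intpart) : monalg.mcoeff (conjp k) g = if sumn k == n then y k else 0.
    rewrite /g raddf_sum /=; case: ifP => sk.
      rewrite (bigD1_seq k) ?partitions_uniq ?mem_partitions //= monalg.mcoeffUU.
      rewrite big1 ?addr0 // => l nl; rewrite monalg.mcoeffU.
      by case: eqP => // /conjp_inj eqlk; rewrite eqlk eqxx in nl.
    rewrite big_seq big1 // => l; rewrite mem_partitions monalg.mcoeffU => sl.
    by case: eqP => // /conjp_inj eqlk; rewrite -eqlk sl in sk.
  have sg : {subset monalg.msupp g <= [seq conjp (k : intpart) | k <- partitions_upto n]}.
    move=> la; rewrite -(conjpK la) -monalg.mcoeff_neq0 gE => nz; apply: map_f.
    by rewrite mem_partitions_upto; move: nz; case: ifP => [/eqP -> _|_]; rewrite ?leqnn ?eqxx.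
  rewrite (big_msupp_sub _ (uL n) sg) big_map [LHS]yP (big_partitions_sub _ (leqnn n)).
  by apply: eq_bigr => k _; rewrite gE; case: ifP => [//|_]; rewrite scale0r.
set g := hl_expansion _ _ _ => gP.
pose m := maxn (maxn n (sumn c)) (\max_(la <- monalg.msupp g) sumn (conjp la)).
have lenm : (n <= m)%N by rewrite /m; lia.
have lecm : (sumn c <= m)%N by rewrite /m; lia.
have sg : {subset monalg.msupp g <= [seq conjp (k : intpart) | k <- partitions_upto m]}.
  move=> la las; rewrite -(conjpK la); apply: map_f; rewrite mem_partitions_upto.
  apply: leq_trans (leq_maxr _ _).
  exact: (leq_bigmax_seq (F := fun la : intpart => sumn (conjp la)) la las isT).
rewrite (big_msupp_sub _ (uL m) sg) big_map in gP.
pose x (k : intpart) := monalg.mcoeff (conjp k) g - (if sumn k == n then y k else 0).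
have /(_ c lecm) : forall k : intpart, (sumn k <= m)%N -> x k = 0.
  apply: (hl_Pc_free char0 t_generic).
  rewrite /x; under eq_bigr do rewrite scalerBl.
  rewrite sumrB; apply/eqP; rewrite subr_eq0; apply/eqP.
  apply: etrans (esym gP) _; apply: etrans yP _; rewrite (big_partitions_sub _ lenm).
  apply: eq_bigr => k _.
  by case: ifP => [//|_]; rewrite scale0r.
by rewrite /x => /eqP; rewrite subr_eq0 => /eqP.
Qed.

Lemma hl_Pc_mul_span (d e : intpart) :
  in_span (fun c : intpart => hl_Pc t c) (sumn d + sumn e) (hl_Pc t d * hl_Pc t e).
Proof.
rewrite mulrC; apply: pspan_hspanM char0 t_generic _ _ _ _ _ _.
  exact: pspan_hl_Pc.
exact: (in_span_basis (fun c : intpart => hl_Pc t c)).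
Qed.

Lemma hl_f_eq0 (c d e : intpart) : sumn c != (sumn d + sumn e)%N ->
  hl_f t (conjp c) (conjp d) (conjp e) = 0.
Proof.
have [y yP] := hl_Pc_mul_span d e.
by rewrite (hl_f_coef yP) => /negPf ->.
Qed.

Lemma hl_f_sum n (d : intpart) (w y : intpart -> K) :
    hl_Pc t d * (\sum_(e <- partitions n) w e *: hl_Pc t e) =
      \sum_(c <- partitions (sumn d + n)) y c *: hl_Pc t c ->
  forall c : intpart, sumn c = (sumn d + n)%N ->
  \sum_(e <- partitions n) hl_f t (conjp c) (conjp d) (conjp e) * w e = y c.
Proof.
move=> wy; apply: hl_Pc_coef; apply: etrans wy; rewrite mulr_sumr.
under eq_bigr do rewrite scaler_suml.
rewrite exchange_big; apply: eq_big_seq => e; rewrite mem_partitions => /eqP sume.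
rewrite -scalerAr; have [z zP] := hl_Pc_mul_span d e.
apply: etrans (congr1 (fun F => w e *: F) (esym zP)); rewrite scaler_sumr sume.
apply: eq_big_seq => c; rewrite mem_partitions => /eqP sumc.
by rewrite scalerA (hl_f_coef zP) sume sumc eqxx mulrC.
Qed.

End StructureConstants.

(** * Plethystic evaluation *)

Section NewtonConvolution.
Variable S : comNzRingType.

Lemma newton_upto_conv n (e e' p p' : nat -> S) :
  newton_upto n e p -> newton_upto n e' p' ->
  newton_upto n (fun r => \sum_(i < r.+1) e i * e' (r - i)%N) (fun r => p r + p' r).
Proof.
pose poly_of f := \poly_(i < n.+1) (f i : S).
pose sgp q := \poly_(i < n) ((-1) ^+ i * (q i.+1 : S)).
have derivE f q : newton_upto n f q -> forall r, (r < n)%N ->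
    (poly_of f)^`()`_r = (sgp q * poly_of f)`_r.
  move=> N r ltrn; rewrite coef_deriv coef_poly ltnS ltrn coefM -mulr_natl N //.
  apply: eq_bigr => i _; rewrite !coef_poly (leq_ltn_trans (leq_ord i) ltrn).
  by rewrite ltnS (leq_trans (leq_subr _ _) (ltnW ltrn)); ring.
move=> N N' r ltrn.
have convE k : (k <= n)%N ->
    \sum_(i < k.+1) e i * e' (k - i)%N = (poly_of e * poly_of e')`_k.
  move=> lekn; rewrite coefM; apply: eq_bigr => i _; rewrite !coef_poly.
  by rewrite !ltnS (leq_trans (leq_ord i) lekn) (leq_trans (leq_subr _ _) lekn).
rewrite convE // mulr_natl -coef_deriv derivM coefD.
have -> : ((poly_of e)^`() * poly_of e')`_r = (sgp p * (poly_of e * poly_of e'))`_r.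
  rewrite mulrA !coefM; apply: eq_bigr => i _; rewrite (derivE _ _ N) //.
  exact: leq_ltn_trans (leq_ord i) ltrn.
have -> : (poly_of e * (poly_of e')^`())`_r = (sgp p' * (poly_of e * poly_of e'))`_r.
  rewrite mulrCA !coefM; apply: eq_bigr => i _; congr (_ * _).
  by rewrite (derivE _ _ N') //; apply: leq_ltn_trans (leq_subr _ _) ltrn.
rewrite -coefD -mulrDl coefM; apply: eq_bigr => i _.
have ltin : (i < n)%N := leq_ltn_trans (leq_ord i) ltrn.
rewrite coefD !coef_poly ltin -mulrDr -convE; last by lia.
by rewrite mulrAC -mulrA.
Qed.

End NewtonConvolution.

Section TwoLetters.
Variables (K : fieldType) (t a b : K).
Hypothesis t_generic : forall r : nat, (0 < r)%N -> t ^+ r != 1.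

Lemma sum_tpow_tfact n :
  \sum_(0 <= j < n.+1) t ^+ j / tfact t j = (tfact t n)^-1.
Proof.
elim: n => [|n IHn]; first by rewrite big_nat1 expr0 tfact0 mul1r.
rewrite big_nat_recr //= IHn tfactS.
by field; rewrite tfact_neq0 // t_generic_sub.
Qed.

Lemma newton_tfact n :
  \sum_(i < n) ((tfact t (n - i.+1))^-1 / (1 - t ^+ i.+1)) = n%:R / tfact t n.
Proof.
elim: n => [|n IHn]; first by rewrite big_ord0 mul0r.
apply: (mulfI (t_generic_sub t_generic n)).
transitivity (\sum_(i < n.+1) ((1 - t ^+ (n - i)) / tfact t (n - i) / (1 - t ^+ i.+1)) +
              \sum_(i < n.+1) t ^+ (n - i) / tfact t (n - i)).
  rewrite mulr_sumr -big_split; apply: eq_bigr => i _ /=; rewrite subSS.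
  have -> : t ^+ n.+1 = t ^+ (n - i) * t ^+ i.+1.
    by rewrite -exprD addnS subnK // leq_ord.
  by field; rewrite tfact_neq0 // t_generic_sub.
have -> : \sum_(i < n.+1) t ^+ (n - i) / tfact t (n - i) = (tfact t n)^-1.
  rewrite -sum_tpow_tfact big_mkord (reindex_inj rev_ord_inj) /=.
  by apply: eq_bigr => i _; rewrite subSS subKn // leq_ord.
rewrite big_ord_recr /= subnn expr0 subrr !mul0r addr0.
rewrite (eq_bigr (fun i : 'I_n => (tfact t (n - i.+1))^-1 / (1 - t ^+ i.+1))).
  by rewrite IHn tfactS -natr1; field; rewrite tfact_neq0 // t_generic_sub.
move=> i _; rewrite -(subnSK (ltn_ord i)) tfactS.
by field; rewrite tfact_neq0 // !t_generic_sub.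
Qed.

Lemma newton_one_letter (c : K) n :
  newton_upto n (fun r => (- c) ^+ r / tfact t r) (fun r => - c ^+ r / (1 - t ^+ r)).
Proof.
move=> r _; rewrite mulrCA -newton_tfact mulr_sumr; apply: eq_bigr => i _.
have -> : (- c) ^+ r.+1 = (- c) ^+ (r - i) * ((-1) ^+ i.+1 * c ^+ i.+1).
  by rewrite -exprNn -exprD addnS subnK // leq_ord.
by rewrite subSS [(-1) ^+ i.+1]exprS; ring.
Qed.

(* h_m[Y/(1-t)]; up to the factor (t;t)_m, a homogeneous Rogers-Szego polynomial. *)
Definition rs_hom (m : nat) : K :=
  \sum_(i < m.+1) (a ^+ i / tfact t i) * (b ^+ (m - i) / tfact t (m - i)).

HB.instance Definition _ := GRing.RMorphism.copy (pleth_neg t a b)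
  (psum_spec idfun (fun r => - (a ^+ r + b ^+ r) / (1 - t ^+ r))).

Lemma pleth_negZ c (F : symfun K) : pleth_neg t a b (c *: F) = c * pleth_neg t a b F.
Proof. exact: psum_specZ. Qed.

Hypothesis char0 : [pchar K] =i pred0.

Lemma pleth_neg_elem r : pleth_neg t a b (elem K r) = (-1) ^+ r * rs_hom r.
Proof.
pose p k := - (a ^+ k + b ^+ k) / (1 - t ^+ k).
pose e k := \sum_(i < k.+1) ((- a) ^+ i / tfact t i) * ((- b) ^+ (k - i) / tfact t (k - i)).
have -> : (-1) ^+ r * rs_hom r = e r.
  rewrite mulr_sumr; apply: eq_bigr => i _.
  have -> : (-1) ^+ r = (-1) ^+ i * (-1) ^+ (r - i) :> K.
    by rewrite -exprD subnKC // leq_ord.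
  by rewrite [(- a) ^+ i]exprNn [(- b) ^+ _]exprNn; ring.
apply: (@newton_upto_elem _ (pleth_neg t a b \o elem K) e p r char0) => //.
- by rewrite /= rmorph1 /e big_ord1 !expr0 tfact0 !divr1 mulr1.
- move=> k ltkr.
  have := rmorph_newton_upto (pleth_neg t a b) (newton_elem char0 (n := r)) ltkr.
  move=> /= ->; apply: eq_bigr => i _; congr (_ * (_ * _)).
  exact: (psum_spec_psum _ _ i).
move=> k ltkr.
rewrite (newton_upto_conv (newton_one_letter a (n := r)) (newton_one_letter b (n := r)) ltkr); apply: eq_bigr => i _; congr (_ * (_ * _)).
by rewrite /p -mulrDl -opprD.
Qed.

End TwoLetters.

Section Linearization.
Variables (K : fieldType) (t a b : K).
Hypothesis t_generic : forall r : nat, (0 < r)%N -> t ^+ r != 1.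
Local Notation rs_hom := (rs_hom t a b).
Local Notation tf := (tfact t).

Lemma rs_homS n : (1 - t ^+ n.+1) * rs_hom n.+1 =
  (a + b) * rs_hom n - (if n is n'.+1 then a * b * rs_hom n' else 0).
Proof.
pose A (x : K) i := x ^+ i / tf i.
have AS x i : (1 - t ^+ i.+1) * A x i.+1 = x * A x i.
  rewrite /A (exprS x) tfactS; move: (t_generic_sub t_generic i) => h.
  by move: (t ^+ i.+1) h => u h; field; rewrite h tfact_neq0.
have -> : (1 - t ^+ n.+1) * rs_hom n.+1 =
    \sum_(i < n.+2) (1 - t ^+ i) * A a i * A b (n.+1 - i)%N +
    (\sum_(i < n.+2) A a i * ((1 - t ^+ (n.+1 - i)) * A b (n.+1 - i)%N) -
     \sum_(i < n.+2) ((1 - t ^+ i) * A a i) * ((1 - t ^+ (n.+1 - i)) * A b (n.+1 - i)%N)).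
  rewrite -sumrB -big_split mulr_sumr; apply: eq_bigr => i _ /=.
  have -> : t ^+ n.+1 = t ^+ i * t ^+ (n.+1 - i) by rewrite -exprD subnKC // leq_ord.
  by rewrite -/(A a i) -/(A b _); ring.
have -> : \sum_(i < n.+2) (1 - t ^+ i) * A a i * A b (n.+1 - i)%N = a * rs_hom n.
  rewrite big_ord_recl expr0 subrr !mul0r add0r mulr_sumr; apply: eq_bigr => i _.
  by rewrite lift0 AS subSS mulrA.
have -> : \sum_(i < n.+2) A a i * ((1 - t ^+ (n.+1 - i)) * A b (n.+1 - i)%N) = b * rs_hom n.
  rewrite big_ord_recr /= subnn expr0 subrr mul0r mulr0 addr0 mulr_sumr.
  by apply: eq_bigr => i _ /=; rewrite subSn ?leq_ord // AS mulrCA.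
rewrite mulrDl -addrA; congr (_ + (_ - _)).
rewrite big_ord_recl expr0 subrr !mul0r add0r.
case: n => [|n]; first by rewrite big_ord1 /= subrr mul0r mulr0.
rewrite big_ord_recr /= [X in _ + X](_ : _ = 0) ?addr0; last first.
  by rewrite /bump add1n subnn expr0 subrr mul0r mulr0.
rewrite mulr_sumr; apply: eq_bigr => i _; rewrite /bump add1n AS subSS subSn ?leq_ord // AS.
by rewrite -/(A a i) -/(A b _); ring.
Qed.

Definition rs_num n := tf n * rs_hom n.

Lemma rs_num0 : rs_num 0 = 1.
Proof. by rewrite /rs_num /rs_hom big_ord1 tfact0 !expr0 !divr1 !mulr1. Qed.

Lemma rs_numS n : (a + b) * rs_num n = rs_num n.+1 + a * b * (1 - t ^+ n) * rs_num n.-1.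
Proof.
rewrite /rs_num tfactS -mulrA rs_homS; case: n => [|n] /=.
  by rewrite expr0 subrr mulr0 mul0r addr0 subr0 mulrCA.
by rewrite tfactS; ring.
Qed.

Definition tfact_inv (m j : nat) : K := if (j <= m)%N then (tf (m - j))^-1 else 0.

Lemma tfact_invS m j : tfact_inv m j.+1 = tfact_inv m j * (1 - t ^+ (m - j)).
Proof.
rewrite /tfact_inv; case: (ltngtP j m) => [ltjm|ltmj|->]; last 2 first.
- by rewrite mul0r.
- by rewrite subnn expr0 subrr mulr0.
by rewrite -(subnSK ltjm) tfactS invfM mulfVK // t_generic_sub.
Qed.

Lemma tfact_invSS m j : tfact_inv m.+1 j.+1 = tfact_inv m j.
Proof. by rewrite /tfact_inv ltnS subSS. Qed.

Lemma tfact_inv_small m j : (m < j)%N -> tfact_inv m j = 0.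
Proof. by rewrite /tfact_inv ltnNge => /negPf ->. Qed.

Definition lin_term m n j : K :=
  (a * b) ^+ j / tf j * tfact_inv m j * tfact_inv n j * rs_num (m + n - j.*2).

Lemma rs_num_linearization m n N : (m < N)%N ->
  tfact_inv m 0 * tfact_inv n 0 * (rs_num m * rs_num n) = \sum_(j < N) lin_term m n j.
Proof.
elim/ltn_ind: m N => m IHm [//|N]; rewrite ltnS => lemN.
case: m IHm lemN => [|m] IHm lemN.
  rewrite big_ord_recl /lin_term big1 => [|j _]; last first.
    by rewrite lift0 (@tfact_inv_small 0) // mulr0 !mul0r.
  by rewrite rs_num0 mul1r addr0 expr0 tfact0 divr1 mul1r subn0.
apply: (mulfI (t_generic_sub t_generic m)).
have inv0 : (1 - t ^+ m.+1) * tfact_inv m.+1 0 = tfact_inv m 0.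
  by rewrite mulrC -[m.+1 in X in 1 - X]subn0 -tfact_invS tfact_invSS.
have IH1 : tfact_inv m 0 * tfact_inv n 0 * (rs_num m * rs_num n) = \sum_(j < N) lin_term m n j.
  exact: IHm.
have IH2 : tfact_inv m 0 * (1 - t ^+ m) * tfact_inv n 0 * (rs_num m.-1 * rs_num n) =
    \sum_(j < N) (a * b) ^+ j / tf j * tfact_inv m j.+1 * tfact_inv n j *
      rs_num (m + n - j.*2).-1.
  case: m IHm lemN {inv0 IH1} => [|m] IHm lemN.
    rewrite expr0 subrr mulr0 !mul0r big1 // => j _.
    by rewrite (@tfact_inv_small 0) // mulr0 !mul0r.
  rewrite -[m.+1 in X in 1 - X]subn0 -tfact_invS tfact_invSS (IHm m _ N) //; last exact: ltnW.
  apply: eq_bigr => j _; rewrite /lin_term tfact_invSS; congr (_ * rs_num _); lia.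
transitivity ((a + b) * (\sum_(j < N) lin_term m n j) - a * b * \sum_(j < N) (a * b) ^+ j / tf j *
   tfact_inv m j.+1 * tfact_inv n j * rs_num (m + n - j.*2).-1).
  rewrite -IH1 -IH2.
  have e : rs_num m.+1 = (a + b) * rs_num m - a * b * (1 - t ^+ m) * rs_num m.-1.
    by rewrite rs_numS addrK.
  by rewrite e !mulrA inv0; ring.
rewrite !mulr_sumr -sumrB.
have -> : \sum_(j < N.+1) (1 - t ^+ m.+1) * lin_term m.+1 n j =
  tfact_inv m 0 * tfact_inv n 0 * rs_num (m.+1 + n) +
  \sum_(j < N) (1 - t ^+ m.+1) * lin_term m.+1 n j.+1.
  rewrite big_ord_recl; congr (_ + _).
  by rewrite /lin_term !mulrA expr0 tfact0 divr1 mulr1 inv0 subn0.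
pose F j := (a * b) ^+ j / tf j * tfact_inv m j * tfact_inv n j * rs_num (m.+1 + n - j.*2).
have -> : tfact_inv m 0 * tfact_inv n 0 * rs_num (m.+1 + n) =
    \sum_(j < N) F j - \sum_(j < N) F j.+1.
  have e1 : \sum_(j < N.+1) F j = F 0%N + \sum_(j < N) F j.+1 by rewrite big_ord_recl.
  have e2 : \sum_(j < N.+1) F j = \sum_(j < N) F j.
    by rewrite big_ord_recr /= {2}/F (@tfact_inv_small m) // mulr0 !mul0r addr0.
  by rewrite -e2 e1 addrK /F expr0 tfact0 divr1 mul1r subn0.
rewrite -sumrB -big_split; apply: eq_bigr => j _ /=.
rewrite /lin_term /F doubleS tfact_invSS !tfact_invS.
have -> : (m.+1 + n - j.*2.+2 = (m + n - j.*2).-1)%N by lia.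
have [ltmj|lejm] := ltnP m j; first by rewrite (tfact_inv_small ltmj) !(mulr0, mul0r) subrr addr0.
have [ltnj|lejn] := ltnP n j; first by rewrite (tfact_inv_small ltnj) !(mulr0, mul0r) subrr addr0.
have -> : (m.+1 + n - j.*2 = (m + n - j.*2).+1)%N by lia.
rewrite [(a + b) * _]mulrCA rs_numS.
have -> : t ^+ (m + n - j.*2) = t ^+ (m - j) * t ^+ (n - j).
  by rewrite -exprD; congr (_ ^+ _); lia.
have -> : t ^+ m.+1 = t ^+ (m - j) * t ^+ j.+1.
  by rewrite -exprD; congr (_ ^+ _); lia.
rewrite tfactS exprS; move: (t_generic_sub t_generic j) (tfact_neq0 t_generic j).
move: (t ^+ j.+1) => T h1 h2.
by field; rewrite h1 h2.
Qed.
End Linearization.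

Lemma nth_mkpart s i : sorted geq s -> nth 0%N (mkpart s) i = nth 0%N s i.
Proof.
by move=> srt; rewrite -(@nth_pad (size s)) ?size_mkpart // pad_mkpart.
Qed.

Lemma big_two_rows (V : nmodType) D (G : intpart -> V) :
    (forall c : intpart, nth 0%N c 2 != 0%N -> G c = 0) ->
  \sum_(c <- partitions D) G c =
  \sum_(0 <= j < D.+1 | (j.*2 <= D)%N) G (mkpart [:: (D - j)%N; j]).
Proof.
move=> G0; rewrite (bigID (fun c : intpart => nth 0%N c 2 == 0%N)) /= addrC big1 ?add0r //.
rewrite -big_filter -[RHS]big_filter -(big_map (fun j => mkpart [:: (D - j)%N; j]) xpredT G).
have srt j : (j.*2 <= D)%N -> sorted geq [:: (D - j)%N; j] by move=> lej /=; rewrite andbT; lia.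
apply: perm_big; apply: uniq_perm => [||c].
- by rewrite filter_uniq // partitions_uniq.
- rewrite map_inj_in_uniq ?filter_uniq ?iota_uniq // => i j.
  rewrite !mem_filter => /andP[lei _] /andP[lej _] /(congr1 (fun c : intpart => nth 0%N c 1)).
  by rewrite !nth_mkpart ?srt.
rewrite mem_filter mem_partitions; apply/andP/mapP => [[/eqP c2 /eqP sumc]|[j + ->]].
  have szc : (size c <= 2)%N.
    rewrite leqNgt; apply/negP => ltc.
    by have /(allP (intpart_gt0 c)) := mem_nth 0%N ltc; rewrite c2.
  have eqc := pad_cat_zeros (subnKC szc).
  exists (nth 0%N c 1).
    rewrite mem_filter mem_index_iota; move: sumc; have := intpart_sorted c.
    case: (parts c) szc {eqc c2} => [|x [|y [|]]] //= _; rewrite ?andbT ?addn0 => *; lia.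
  rewrite -[LHS](mkpart_pad szc) /pad /=; congr mkpart; congr [:: _ ; _].
  by move: sumc; case: (parts c) szc {eqc c2} => [|x [|y [|]]] //= _; lia.
rewrite mem_filter mem_index_iota => /andP[lej _].
by rewrite nth_mkpart ?srt // sumn_mkpart /=; split=> //; apply/eqP; lia.
Qed.

Section PlethysticValues.
Variables (K : fieldType) (t a b : K).
Hypothesis char0 : [pchar K] =i pred0.
Hypothesis t_generic : forall r : nat, (0 < r)%N -> t ^+ r != 1.
Local Notation tf := (tfact t).

(* P_la[-Y/(1-t)], as a function of the conjugate c of la. *)
Definition pleth_value (c : seq nat) : K :=
  if nth 0%N c 2 == 0%N then
    (a * b) ^+ nth 0%N c 1 * (-1) ^+ (nth 0%N c 0 - nth 0%N c 1) *
    rs_hom t a b (nth 0%N c 0 - nth 0%N c 1) / tf (nth 0%N c 1)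
  else 0.

Lemma pieri_two_rows (x y : nat) (d : seq nat) :
  pieri t [:: x; y] d =
  (if (y <= nth 0%N d 0 <= x)%N then gbin t (x - y) (x - nth 0%N d 0) else 0) *
  ((if (nth 0%N d 1 <= y)%N then gbin t y (y - nth 0%N d 1) else 0) *
   (all (pred1 0%N) (behead (behead d)))%:R).
Proof. by rewrite /= !subn0 -!nth0 nth_behead. Qed.

Lemma pieri_nth2_eq0 (c d : intpart) : nth 0%N d 2 != 0%N -> nth 0%N c 2 = 0%N ->
  pieri t c d = 0.
Proof.
move=> d2 c2; apply/eqP; apply: contraNT d2 => /(pieri_neq0_nth 2%N)[_].
by rewrite c2 leqn0.
Qed.

Lemma pleth_value_pieri r (d : intpart) :
  (-1) ^+ r * rs_hom t a b r * pleth_value d =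
  \sum_(c <- partitions (sumn d + r)) pieri t c d * pleth_value c.
Proof.
case: (eqVneq (nth 0%N d 2) 0%N) => [d2|d2]; last first.
  rewrite {1}/pleth_value (negPf d2) mulr0 big1 // => c _; rewrite /pleth_value.
  by case: eqP => [c2|_]; rewrite ?mulr0 // pieri_nth2_eq0 ?mul0r.
rewrite big_two_rows => [|c /negPf c2]; last by rewrite /pleth_value c2 mulr0.
set d1 := nth 0%N d 0; set d0 := nth 0%N d 1.
have szd : (size d <= 2)%N.
  rewrite leqNgt; apply/negP => ltd.
  by have /(allP (intpart_gt0 d)) := mem_nth 0%N ltd; rewrite d2.
have dd : all (pred1 0%N) (behead (behead d)) by case: (parts d) szd => [|? [|? []]].
have le01 : (d0 <= d1)%N.
  rewrite /d0 /d1; have := intpart_sorted d.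
  by case: (parts d) => [|? [|? ?]] //= /andP[].
have sumd : sumn d = (d1 + d0)%N.
  by rewrite /d1 /d0; case: (parts d) szd => [|? [|? []]] //= *; lia.
rewrite sumd; set D := (d1 + d0 + r)%N.
rewrite (eq_bigr (fun j => pieri t [:: (D - j)%N; j] d * pleth_value [:: (D - j)%N; j])); last first.
  move=> j lej; have srt : sorted geq [:: (D - j)%N; j] by rewrite /= andbT; lia.
  by rewrite pieri_mkpartl // /pleth_value !nth_mkpart.
rewrite (@big_cat_nat _ _ _ d0) //; last by rewrite /D; lia.
rewrite big_nat_cond big1 => [|j /andP[/andP[_ ltj] lej]]; last first.
  rewrite pieri_two_rows -/d0 -/d1 (leqNgt d0) ltj /=.
  by rewrite mul0r mulr0 mul0r.
rewrite -[index_iota d0 _]/(index_iota (0 + d0) _) big_addn big_mkcond big_mkord.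
have ltr : (r < D.+1 - d0)%N by rewrite /D; lia.
have lin := rs_num_linearization a b t_generic (d1 - d0) ltr.
transitivity ((a * b) ^+ d0 * (-1) ^+ r * (-1) ^+ (d1 - d0) / tf d0 *
    \sum_(j < D.+1 - d0) lin_term t a b r (d1 - d0) j).
  rewrite -lin /tfact_inv /= !subn0 /rs_num /pleth_value d2 eqxx -/d0 -/d1.
  by field; rewrite !tfact_neq0.
rewrite [RHS]add0r mulr_sumr; apply: eq_bigr => i _; rewrite /lin_term.
move: (nat_of_ord i) => {}i.
have [/andP[ler leiq]|out] := boolP ((i <= r) && (i <= d1 - d0))%N; last first.
  rewrite (_ : _ * _ * _ * _ = 0) ?mulr0 //; last first.
    by move: out; rewrite negb_and -!ltnNge => /orP[] lt; rewrite (tfact_inv_small t lt) !(mulr0, mul0r).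
  case: ifP => // lej.
  rewrite pieri_two_rows -/d0 -/d1; case: ifP => [/andP[h1 h2]|_].
    by case/negP: out; apply/andP; split; move: h1 h2; rewrite /D; lia.
  by rewrite mul0r mul0r.
have lej : ((i + d0).*2 <= D)%N by rewrite /D; lia.
rewrite lej pieri_two_rows -/d0 -/d1 dd mulr1 /pleth_value /=.
rewrite leq_addl addnK.
have -> : (i + d0 <= d1 <= D - (i + d0))%N by rewrite /D; lia.
have -> : (D - (i + d0) - (i + d0) = r + (d1 - d0) - i.*2)%N by rewrite /D; lia.
have -> : (D - (i + d0) - d1 = r - i)%N by rewrite /D; lia.
rewrite /tfact_inv ler leiq !gbinE //; [|by lia|by lia].
have -> : (r + (d1 - d0) - i.*2 - (r - i) = d1 - d0 - i)%N by lia.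
rewrite addKn /rs_num [in RHS]exprD.
have -> : (-1) ^+ (r + (d1 - d0) - i.*2) = (-1) ^+ r * (-1) ^+ (d1 - d0) :> K.
  by rewrite -exprD -signr_odd oddB ?odd_double ?addbF ?signr_odd //; lia.
by field; rewrite !tfact_neq0.
Qed.

Lemma pleth_hl_Pc (c : intpart) : pleth_neg t a b (hl_Pc t c) = pleth_value c.
Proof.
elim/conj_ind: c => [|c cp IHt IHk].
  rewrite hl_Pc_nil // rmorph1 /pleth_value (_ : mkpart [::] = [::] :> seq nat) //=.
  by rewrite !expr0 tfact0 !mul1r /rs_hom big_ord1 !expr0 tfact0 !divr1 mulr1.
rewrite hl_Pc_rec // rmorphB rmorphM rmorph_sum /= IHt pleth_neg_elem //.
rewrite pleth_value_pieri addnC -sumn_tailp.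
rewrite (@big_pieri_tailp _ _ t_generic _ c (fun p k => p * pleth_value k)); last first.
  by move=> k; rewrite mul0r.
rewrite mul1r [X in _ - X](_ : _ = \sum_(k <- partitions (sumn c) | (head 0 c < head 0 k)%N)
    pieri t k (tailp c) * pleth_value k) ?addrK //.
rewrite big_seq_cond [RHS]big_seq_cond; apply: eq_bigr => k /andP[].
rewrite mem_partitions => /eqP sumk ltk.
by rewrite [LHS]pleth_negZ IHk.
Qed.

End PlethysticValues.

Lemma count_mem_card (x : nat) (s : seq nat) :
  count_mem x s = #|[pred j : 'I_(size s) | nth 0%N s j == x]|.
Proof. by rewrite -sum1_count (big_nth 0%N) big_mkord sum1_card. Qed.

Lemma mult_conjp (c : intpart) i :
  mult (conjp c) i.+1 = (nth 0%N c i - nth 0%N c i.+1)%N.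
Proof.
rewrite /mult count_mem_card; apply: card_conj_mult.
by rewrite size_conjp ?intpart_sorted.
Qed.

Lemma head_conjp (c : intpart) : head 0%N (conjp c) = size c.
Proof. by rewrite -[c in RHS]conjpK size_conjp // intpart_sorted. Qed.

Section SkewFunctions.
Variables (K : fieldType) (t a b : K).
Hypothesis char0 : [pchar K] =i pred0.
Hypothesis t_generic : forall r : nat, (0 < r)%N -> t ^+ r != 1.
Local Notation tf := (tfact t).

Lemma elem_row s : elem K s = hl_Pc t (mkpart [:: s]).
Proof.
have hs : head 0%N (mkpart [:: s]) = s by rewrite head_mkpart.
have ts : tailp (mkpart [:: s]) = mkpart [::].
  apply: intpart_inj; rewrite tailpE mkpartE //=.
  by case: (s).
rewrite hl_Pc_rec // ts hl_Pc_nil // mulr1 hs big_seq_cond big1 ?subr0 // => k /andP[].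
rewrite mem_partitions sumn_mkpart /= addn0 => /eqP sumk; rewrite -sumk ltnNge.
by case: (parts k) => //= x u; rewrite leq_addr.
Qed.

Lemma hl_b_pleth_value (e : intpart) :
  hl_b t (conjp e) * pleth_value t a b e =
  \sum_(s < (sumn e).+1) (- b) ^+ (sumn e - s) * (- a) ^+ s * pieri t e [:: nat_of_ord s].
Proof.
case: (eqVneq (nth 0%N e 2) 0%N) => [e2|e2]; last first.
  rewrite /pleth_value (negPf e2) mulr0 big1 // => s _.
  suff -> : pieri t e [:: nat_of_ord s] = 0 by rewrite mulr0.
  apply/eqP; apply: contraNT e2 => /(pieri_neq0_nth 1%N)[].
  by rewrite /= leqn0.
have sze : (size e <= 2)%N.
  rewrite leqNgt; apply/negP => lte.
  by have /(allP (intpart_gt0 e)) := mem_nth 0%N lte; rewrite e2.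
have hb : hl_b t (conjp e) = tf (nth 0%N e 0 - nth 0%N e 1) * tf (nth 0%N e 1).
  rewrite /hl_b head_conjp big_add1.
  rewrite (eq_bigr (fun i => tf (nth 0%N e i - nth 0%N e i.+1))) => [|i _]; last first.
    by rewrite mult_conjp.
  rewrite succnK; case: (parts e) sze {e2} => [|x [|y [|]]] //= _.
  - by rewrite big_nil tfact0 mulr1.
  - by rewrite big_nat1 /= tfact0 mulr1.
  - by rewrite !big_nat_recr //= big_nil mul1r subn0.
have le21 : (nth 0%N e 1 <= nth 0%N e 0)%N.
  by have := intpart_sorted e; case: (parts e) => [|? [|? ?]] //= /andP[].
have sume : sumn e = (nth 0%N e 0 + nth 0%N e 1)%N.
  by case: (parts e) sze {e2 hb} => [|? [|? []]] //= *; lia.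
have pieriE s : pieri t e [:: s] = if (nth 0%N e 1 <= s <= nth 0%N e 0)%N
    then gbin t (nth 0%N e 0 - nth 0%N e 1) (nth 0%N e 0 - s) else 0.
  rewrite -{1}(mkpart_pad sze) (pieri_mkpartl t_generic); last by rewrite /= andbT.
  by rewrite /= !subn0 gbinn // !mulr1.
rewrite hb /pleth_value e2 eqxx sume.
move: (nth 0%N e 0) (nth 0%N e 1) le21 pieriE => x y leyx pieriE.
rewrite -(big_mkord xpredT (fun s => (- b) ^+ (x + y - s) * (- a) ^+ s * pieri t e [:: s])).
rewrite (@big_cat_nat _ _ _ y) //; last by lia.
rewrite [X in _ = _ X _]big_nat_cond [X in _ = _ X _]big1; last first.
  by move=> s /andP[/andP[_ lts] _]; rewrite pieriE leqNgt lts mulr0.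
rewrite [RHS]add0r (@big_cat_nat _ _ _ x.+1) //; [|by lia|by lia].
rewrite [X in _ = _ _ X]big_nat_cond [X in _ = _ _ X]big1; last first.
  by move=> s /andP[/andP[lts _] _]; rewrite pieriE [(s <= x)%N]leqNgt lts andbF mulr0.
rewrite [RHS]addr0 -[index_iota y _]/(index_iota (0 + y) _) big_addn.
rewrite subSn // big_mkord /rs_hom.
rewrite [LHS](_ : _ = (a * b) ^+ y * (-1) ^+ (x - y) * tf (x - y) *
  \sum_(i < (x - y).+1) a ^+ i / tf i * (b ^+ (x - y - i) / tf (x - y - i))); last first.
  by field; rewrite tfact_neq0.
rewrite mulr_sumr; apply: eq_bigr => i _; rewrite pieriE.
have lei : (i <= x - y)%N := leq_ord i.
move: (nat_of_ord i) lei => {}i lei.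
have -> : (y <= i + y <= x)%N by lia.
have -> : (x - (i + y) = x - y - i)%N by lia.
rewrite gbin_sym // gbinE //.
have -> : (x + y - (i + y) = y + (x - y - i))%N by lia.
rewrite [(- b) ^+ _]exprNn [(- a) ^+ _]exprNn !exprD exprMn.
have -> : (-1) ^+ (x - y) = (-1) ^+ i * (-1) ^+ (x - y - i) :> K by rewrite -exprD subnKC.
have sq : (-1) ^+ y * (-1) ^+ y = 1 :> K by rewrite -expr2 sqrr_sign.
rewrite -[LHS]mul1r -[X in X * _]sq.
by field; rewrite !tfact_neq0.
Qed.

Lemma sum_hl_b_pleth_value n :
  \sum_(e <- partitions n) (hl_b t (conjp e) * pleth_value t a b e) *: hl_Pc t e =
  \sum_(s < n.+1) ((- b) ^+ (n - s) * (- a) ^+ s) *: (elem K (n - s) * elem K s).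
Proof.
transitivity (\sum_(e <- partitions n) \sum_(s < n.+1)
    ((- b) ^+ (n - s) * (- a) ^+ s * pieri t e [:: nat_of_ord s]) *: hl_Pc t e).
  apply: eq_big_seq => e; rewrite mem_partitions => /eqP sume.
  by rewrite hl_b_pleth_value sume scaler_suml.
rewrite exchange_big; apply: eq_bigr => s _.
have sm : sumn (mkpart [:: nat_of_ord s]) = s by rewrite sumn_mkpart /= addn0.
rewrite (elem_row s) (elem_hl_Pc char0 t_generic) sm (subnKC (leq_ord s)) scaler_sumr.
apply: eq_bigr => e _; rewrite scalerA pieri_mkpartr; first exact: erefl.
exact: isT.
Qed.

Lemma pieri_eq0_sumn (c d : seq nat) : (sumn c < sumn d)%N -> pieri t c d = 0.
Proof.
rewrite ltnNge => H; apply/eqP; apply: contraNT H => nz; apply: leq_sumn_nth => i.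
by have [] := pieri_neq0_nth i nz.
Qed.

Lemma hl_Q'skew_conjp (c d : intpart) :
  hl_Q'skew t a b (conjp c) (conjp d) =
  \sum_(e <- partitions_upto (sumn c))
    (- b) ^+ (sumn c - sumn e) * (- a) ^+ (sumn e - sumn d) * (pieri t c e * pieri t e d).
Proof.
pose n := (sumn c - sumn d)%N.
have [ledc|ltcd] := leqP (sumn d) (sumn c); last first.
  rewrite [RHS]big_seq big1 => [|e].
    rewrite /hl_Q'skew /hl_Qskew fsbig1 ?rmorph0 // => nu _.
    rewrite -(conjpK nu) hl_f_eq0 ?scale0r //; lia.
  rewrite mem_partitions_upto => lee; rewrite [pieri t e d]pieri_eq0_sumn ?mulr0 //.
  exact: leq_ltn_trans lee ltcd.
transitivity (\sum_(e <- partitions n)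
  hl_f t (conjp c) (conjp d) (conjp e) * (hl_b t (conjp e) * pleth_value t a b e)).
  rewrite /hl_Q'skew /hl_Qskew (@fsbigE _ _ _ _ _ [seq conjp (e : intpart) | e <- partitions n]).
  - rewrite (eq_bigl xpredT) => [|nu]; last by rewrite in_setT.
    rewrite big_map rmorph_sum; apply: eq_bigr => e _.
    by rewrite [LHS]pleth_negZ /hl_Q pleth_negZ pleth_hl_Pc.
  - by rewrite map_inj_uniq ?partitions_uniq // => k l /conjp_inj.
  - by move=> nu _.
  - move=> nu _ nin; rewrite -(conjpK nu) hl_f_eq0 ?scale0r //.
    apply: contra nin => /eqP sumc; rewrite -(conjpK nu); apply: map_f.
    by rewrite mem_partitions; apply/eqP; rewrite /n; lia.
pose y (k : intpart) := \sum_(s < n.+1) \sum_(e <- partitions (sumn d + s))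
  (- b) ^+ (n - s) * (- a) ^+ s * (pieri t k e * pieri t e d).
rewrite (@hl_f_sum _ _ char0 t_generic n d _ y); last 2 first.
- rewrite sum_hl_b_pleth_value mulr_sumr.
  under [RHS]eq_bigr do rewrite scaler_suml.
  rewrite [RHS]exchange_big; apply: eq_bigr => s _.
  rewrite -scalerAr [hl_Pc t d * _]mulrC -mulrA (elem_hl_Pc char0 t_generic) mulr_sumr scaler_sumr.
  under [RHS]eq_bigr do rewrite scaler_suml.
  rewrite [RHS]exchange_big; apply: eq_big_seq => e; rewrite mem_partitions => /eqP sume.
  rewrite -scalerAr scalerA (elem_hl_Pc char0 t_generic) sume -addnA subnKC ?leq_ord // scaler_sumr.
  apply: eq_bigr => k _; rewrite scalerA -[X in X *: _]mulrA [pieri t e d * _]mulrC.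
  exact: erefl.
- by rewrite /n subnKC.
rewrite /y big_partitions_upto (@big_cat_nat _ _ _ (sumn d)) //; last exact: leqW.
rewrite [X in _ = _ X _]big_nat_cond [X in _ = _ X _]big1; last first.
  move=> i /andP[/andP[_ lti] _]; rewrite big_seq big1 // => e; rewrite mem_partitions => /eqP sume.
  by rewrite [pieri t e d]pieri_eq0_sumn ?sume // !mulr0.
rewrite [RHS]add0r -[index_iota (sumn d) _]/(index_iota (0 + sumn d) _) big_addn subSn //.
rewrite big_mkord; apply: eq_bigr => s _; rewrite addnC.
apply: eq_big_seq => e; rewrite mem_partitions => /eqP ->.
by rewrite addnK /n; congr (_ ^+ _ * _ * _); lia.
Qed.

End SkewFunctions.

(** * The sum over even partitions *)

Section AlternatingConjugates.

Lemma seq2_ind (P : seq nat -> Prop) : P [::] -> (forall x, P [:: x]) ->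
  (forall x y s, P s -> P [:: x, y & s]) -> forall s, P s.
Proof.
move=> P0 P1 P2 s; have [n] := ubnP (size s); elim: n s => // n IHn.
by case=> [|x [|y s]] //= lts; apply: P2; apply: IHn; lia.
Qed.

(* The number of odd parts of the conjugate of [s]. *)
Fixpoint alt_sum (s : seq nat) : nat :=
  match s with
  | [:: x, y & s'] => (x - y) + alt_sum s'
  | [:: x] => x
  | [::] => 0
  end.

(* The conjugate of [s] has only even parts. *)
Fixpoint even_conj (s : seq nat) : bool :=
  match s with
  | [:: x, y & s'] => (x == y) && even_conj s'
  | [:: x] => x == 0%N
  | [::] => true
  end.

Lemma conj_word_cons2 n x y s : sorted geq [:: x, y & s] -> (x <= n)%N ->
  conj_word n [:: x, y & s] =
  map succn (map succn (conj_word y s)) ++ nseq (x - y) 1%N ++ nseq (n - x) 0%N.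
Proof.
move=> srt lexn; have /= /andP[leyx srt'] := srt.
by rewrite conj_word_cons // conj_word_cons // map_cat map_nseq catA.
Qed.

Lemma conj_word1 n x : (x <= n)%N -> conj_word n [:: x] = nseq x 1%N ++ nseq (n - x) 0%N.
Proof. by move=> lexn; rewrite conj_word_cons // conj_word_nil map_nseq. Qed.

Lemma count_odd_conj_word n s : sorted geq s -> (head 0%N s <= n)%N ->
  count odd (conj_word n s) = alt_sum s.
Proof.
elim/seq2_ind: s n => [|x|x y s IHs] n srt len.
- by rewrite conj_word_nil count_nseq.
- by rewrite conj_word1 // count_cat !count_nseq /= mul1n addn0.
have /= /andP[leyx srt'] := srt.
rewrite conj_word_cons2 // !count_cat !count_nseq !count_map /= mul1n mul0n addn0 addnC.
rewrite -(IHs y) ?(path_sorted srt') //; last by case: (s) srt' => //= z s' /andP[].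
by rewrite [in RHS]count_map; congr (_ + _)%N; apply: eq_count => i /=; rewrite negbK.
Qed.

Lemma even_conj_word n s : sorted geq s -> (head 0%N s <= n)%N ->
  all (fun i => ~~ odd i) (conj_word n s) = even_conj s.
Proof.
elim/seq2_ind: s n => [|x|x y s IHs] n srt len.
- by rewrite conj_word_nil all_nseq orbT.
- by rewrite conj_word1 // all_cat !all_nseq /= orbT andbT orbF.
have /= /andP[leyx srt'] := srt.
rewrite conj_word_cons2 // !all_cat !all_nseq !all_map /= orbT andbT orbF andbC.
rewrite -(IHs y) ?(path_sorted srt') //; last by case: (s) srt' => //= z s' /andP[].
congr (_ && _); first by rewrite subn_eq0 eqn_leq leyx andbT.
by rewrite [in RHS]all_map; apply: eq_all => i /=; rewrite negbK.
Qed.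

Lemma alt_sum_mkpart s : sorted geq s -> alt_sum (mkpart s) = alt_sum s.
Proof.
move=> srt; rewrite -(@count_odd_conj_word (head 0%N s)) ?intpart_sorted ?head_mkpart //.
rewrite -[RHS](@count_odd_conj_word (head 0%N s)) //.
by rewrite -(conj_word_zeros _ (mkpart s) (count_mem 0%N s)) -sorted_mkpart.
Qed.

Lemma even_partition_conjp s : sorted geq s -> even_partition (conjp s) = even_conj s.
Proof. by move=> srt; rewrite /even_partition conjpE // even_conj_word. Qed.

Lemma size_odd_parts_conjp (c : intpart) : size (odd_parts (conjp c)) = alt_sum c.
Proof. by rewrite size_filter conjpE ?count_odd_conj_word ?intpart_sorted. Qed.

End AlternatingConjugates.

Section EvenSums.
Variables (K : fieldType) (t a b : K).
Hypothesis t_generic : forall r : nat, (0 < r)%N -> t ^+ r != 1.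

Lemma interlaced_head x c d : d \in interlaced (x :: c) ->
  exists2 d', d = head 0%N d :: d' & d' \in interlaced c /\ (head 0 c <= head 0 d <= x)%N.
Proof.
case/allpairsP => [[y u] [/= + uP ->]]; rewrite mem_index_iota ltnS => yP.
by exists u.
Qed.

(* Only d = (e_2, e_2, e_4, e_4, ...) contributes. *)
Lemma sum_interlaced_even e : sorted geq e ->
  \sum_(d <- interlaced e)
     (if even_conj d then (- a) ^+ (sumn e - sumn d) * pieri t e d else 0) =
  (- a) ^+ alt_sum e.
Proof.
elim/seq2_ind: e => [|x|x y e IHe] srt.
- by rewrite /= big_seq1 /= mulr1.
- have m0 : [:: 0%N] \in interlaced [:: x].
    by apply/allpairsP; exists (0%N, [::]); rewrite mem_index_iota.
  rewrite (bigD1_seq _ m0 (interlaced_uniq _)) big_seq_cond big1 => [|d /andP[dP]].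
    by rewrite [LHS]addr0 /= !subn0 addn0 gbinn // !mulr1.
  have [d' -> [+ _]] := interlaced_head dP; rewrite inE => /eqP ->.
  by case: (head 0%N d) => [|h]; rewrite ?eqxx.
have [leyx srt'] : (y <= x)%N /\ path geq y e by apply/andP.
have ley : (head 0 e <= y)%N by case: (e) srt' => //= z s /andP[].
rewrite -[alt_sum [:: x, y & e]]/((x - y) + alt_sum e)%N exprD -(IHe (path_sorted srt')) {IHe}.
have inj2 : injective (fun d : seq nat => [:: y, y & d]) by move=> ? ? [].
pose f d := if even_conj d then
  (- a) ^+ (sumn [:: x, y & e] - sumn d) * pieri t [:: x, y & e] d else 0.
have f0 d : d \in interlaced [:: x, y & e] ->
    d \notin [seq [:: y, y & d] | d <- interlaced e] -> f d = 0.
  move=> /interlaced_head[d1 -> [/interlaced_head[d2 -> [d2P /andP[le3 le4]]] /andP[le1 le2]]].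
  rewrite /f /= in le1 *; case: ifP => // /andP[/eqP eqd _] /negP[].
  have eqy : head 0%N d1 = y by move: le1 le4; rewrite /= eqd; lia.
  by rewrite eqd eqy map_f.
transitivity (\sum_(d <- [seq [:: y, y & d] | d <- interlaced e]) f d).
  rewrite (bigID (fun d => d \in [seq [:: y, y & d] | d <- interlaced e])).
  rewrite [X in _ _ X = _]big_seq_cond [X in _ _ X = _]big1 => [|d /andP[]]; last exact: f0.
  rewrite [LHS]addr0.
  rewrite -big_filter; apply: perm_big; apply: uniq_perm => [||d].
  - apply: filter_uniq; exact: interlaced_uniq.
  - by rewrite map_inj_uniq // interlaced_uniq.
  rewrite mem_filter andb_idr // => /mapP[d' d'P ->].
  apply/allpairsP; exists (y, y :: d'); rewrite /= mem_index_iota ltnS leyx leqnn; split=> //.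
  by apply/allpairsP; exists (y, d'); rewrite /= mem_index_iota ltnS leqnn ley.
rewrite big_map mulr_sumr; apply: eq_big_seq => d dP.
have [_ led lesum _] := interlacedP dP.
rewrite /f /= eqxx !leqnn leyx ley /= gbinn // subnn gbin0 // !mul1r.
case: ifP => _; last by rewrite mulr0.
rewrite mulrA -exprD; congr (_ ^+ _ * _); lia.
Qed.

Fixpoint alt_pow (x : K) (s : seq nat) : K :=
  if s is y :: s' then x ^+ y * alt_pow x^-1 s' else 1.

Lemma alt_powE x s : x != 0 -> sorted geq s -> x ^+ alt_sum s = alt_pow x s.
Proof.
move=> x0; elim/seq2_ind: s => [|y|y z s IHs] //= srt; first by rewrite mulr1.
have /andP[lezy srt'] := srt; rewrite exprD (IHs (path_sorted srt')) invrK mulrA.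
congr (_ * _); rewrite -[in RHS](subnK lezy) exprD exprVn -mulrA mulfV ?mulr1 //.
by rewrite expf_neq0.
Qed.

Fixpoint rs_alt (x : K) (c : seq nat) : K :=
  if c is c1 :: c' then
    x ^+ c1 * rogers_szego t (c1 - head 0%N c') (- b / x) * rs_alt x^-1 c'
  else 1.

Lemma sum_interlaced_alt x c : x != 0 -> sorted geq c ->
  \sum_(e <- interlaced c) (- b) ^+ (sumn c - sumn e) * pieri t c e * alt_pow x e =
  rs_alt x c.
Proof.
elim: c x => [|c1 c IHc] x x0 srt; first by rewrite big_seq1 /= !mulr1.
have lec : (head 0 c <= c1)%N by case: (c) srt => //= z s /andP[].
rewrite big_allpairs_dep /= -(IHc x^-1) ?invr_eq0 ?(path_sorted srt) //.
pose m := (c1 - head 0 c)%N.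
transitivity (\sum_(head 0%N c <= y < c1.+1) ((- b) ^+ (c1 - y) * gbin t m (c1 - y) * x ^+ y) *
   \sum_(e <- interlaced c) (- b) ^+ (sumn c - sumn e) * pieri t c e * alt_pow x^-1 e).
  apply: eq_big_nat => y /andP[ley]; rewrite ltnS => ly1.
  rewrite mulr_sumr; apply: eq_big_seq => e eP.
  have [_ _ lesum _] := interlacedP eP; rewrite ley ly1 /=.
  rewrite (_ : c1 + sumn c - (y + sumn e) = (c1 - y) + (sumn c - sumn e))%N; last by lia.
  by rewrite exprD; ring.
rewrite -mulr_suml; congr (_ * _).
rewrite -[index_iota (head 0%N c) _]/(index_iota (0 + head 0%N c) _) big_addn subSn //.
rewrite -/m big_nat_rev /= /rogers_szego mulr_sumr; apply: eq_big_nat => i /andP[_].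
rewrite ltnS add0n subSS => lei.
rewrite (_ : c1 - (m - i + head 0 c) = i)%N; last by rewrite /m in lei *; lia.
rewrite /gbin lei (_ : m - i + head 0 c = c1 - i)%N; last by rewrite /m in lei *; lia.
have le1 : (i <= c1)%N by rewrite /m in lei; lia.
rewrite -[in RHS](subnK le1) exprD expr_div_n.
by field; rewrite expf_neq0.
Qed.

Lemma rs_altE x c : x != 0 ->
  rs_alt x c = alt_pow x c *
    \prod_(0 <= i < size c)
       rogers_szego t (nth 0%N c i - nth 0%N c i.+1) (- b / (if odd i then x^-1 else x)).
Proof.
elim: c x => [|c1 c IHc] x x0; first by rewrite big_nil mulr1.
rewrite /= IHc ?invr_eq0 // big_nat_recl //= nth0 invrK.
rewrite [X in _ = _ * (_ * X)](eq_bigr (fun i =>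
  rogers_szego t (nth 0%N c i - nth 0%N c i.+1) (- b / (if odd i then x else x^-1)))).
  by rewrite !mulrA; congr (_ * _); rewrite -!mulrA; congr (_ * _); rewrite mulrC.
by move=> i _; case: (odd i).
Qed.

Lemma rogers_szego0 z : rogers_szego t 0 z = 1.
Proof. by rewrite /rogers_szego big_nat1 expr0 mul1r /tbinom tfact0 mulr1 divr1. Qed.

Lemma rs_h_filter (p : pred nat) (c : intpart) z :
  rs_h t (filter_parts p (conjp c)) z =
  \prod_(0 <= i < size c)
    (if p i.+1 then rogers_szego t (nth 0%N c i - nth 0%N c i.+1) z else 1).
Proof.
set la := filter_parts p (conjp c).
have mla i : mult la i.+1 = if p i.+1 then (nth 0%N c i - nth 0%N c i.+1)%N else 0%N.
  rewrite /mult /la /= count_filter; case: ifP => pi.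
    by rewrite -mult_conjp; apply: eq_count => j /=; case: eqP => // ->; rewrite pi.
  rewrite (@eq_count _ _ pred0) ?count_pred0 // => j /=.
  by case: eqP => // ->; rewrite pi.
have leh : (head 0 la <= size c)%N.
  rewrite -head_conjp; case E : (parts la) => [|x s] //=.
  have : x \in filter p (conjp c) by rewrite -[filter _ _]/(parts la) E mem_head.
  by rewrite mem_filter => /andP[_]; exact: (leq_head (intpart_sorted _)).
have RS i : rogers_szego t (mult la i.+1) z =
    if p i.+1 then rogers_szego t (nth 0%N c i - nth 0%N c i.+1) z else 1.
  by rewrite mla; case: (p _) => //; rewrite rogers_szego0.
rewrite /rs_h big_add1 succnK -(eq_bigr _ (fun i _ => RS i)).
rewrite [RHS](@big_cat_nat _ _ _ (head 0%N la)) //= [X in _ = _ * X]big_nat_cond.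
rewrite [X in _ = _ * X]big1 ?mulr1 // => i /andP[/andP[lei _] _].
rewrite (_ : mult la i.+1 = 0%N) ?rogers_szego0 //; apply/count_memPn/negP => iP.
by have := leq_head (intpart_sorted la) iP; rewrite leqNgt ltnS lei.
Qed.

End EvenSums.

Section EvenTheorem.
Variables (K : fieldType) (t a b : K).
Hypothesis char0 : [pchar K] =i pred0.
Hypothesis t_generic : forall r : nat, (0 < r)%N -> t ^+ r != 1.

Lemma sum_hl_Q'skew_even (c : intpart) :
  \sum_(mu \in [set mu : intpart | even_partition mu]%classic)
     hl_Q'skew t a b (conjp c) mu =
  \sum_(d <- partitions_upto (sumn c) | even_partition (conjp d))
     hl_Q'skew t a b (conjp c) (conjp d).
Proof.
transitivity (\sum_(mu <- [seq conjp (d : intpart) | d <- partitions_upto (sumn c)] |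
    even_partition mu) hl_Q'skew t a b (conjp c) mu); last by rewrite big_map.
rewrite [RHS]bigfs.
- by apply: eq_fsbigl.
- by rewrite map_inj_uniq ?partitions_upto_uniq // => d e /conjp_inj.
move=> mu _ muN; rewrite -(conjpK mu) hl_Q'skew_conjp // big_seq big1 // => e.
rewrite mem_partitions_upto => lee.
have ltc : (sumn c < sumn (conjp mu))%N.
  rewrite ltnNge; apply: contra muN => le; rewrite -(conjpK mu); apply: map_f.
  by rewrite mem_partitions_upto.
by rewrite [pieri t e _]pieri_eq0_sumn ?mulr0 // (leq_ltn_trans lee ltc).
Qed.

Lemma sum_pieri_even n (e : intpart) : (sumn e <= n)%N ->
  \sum_(d <- partitions_upto n | even_partition (conjp d))
     (- a) ^+ (sumn e - sumn d) * pieri t e d = (- a) ^+ alt_sum e.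
Proof.
move=> len; rewrite -(sum_interlaced_even a t_generic (intpart_sorted e)) big_mkcond.
rewrite (big_interlaced t (G := fun p d => if even_partition (conjp d) then
  (- a) ^+ (sumn e - sumn d) * p else 0)) //; last first.
  by move=> d; rewrite mulr0 if_same.
apply: eq_big_seq => d dP; have [_ _ _ srt] := interlacedP dP.
by rewrite conjp_mkpart // even_partition_conjp // sumn_mkpart.
Qed.

Lemma sum_hl_Q'skew_even_alt (c : intpart) : a != 0 ->
  \sum_(d <- partitions_upto (sumn c) | even_partition (conjp d))
     hl_Q'skew t a b (conjp c) (conjp d) = rs_alt t b (- a) c.
Proof.
move=> a0; have na0 : - a != 0 by rewrite oppr_eq0.
under eq_bigr do rewrite hl_Q'skew_conjp //.
rewrite exchange_big /=.
transitivity (\sum_(e <- partitions_upto (sumn c))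
    (- b) ^+ (sumn c - sumn e) * pieri t c e * (- a) ^+ alt_sum e).
  apply: eq_big_seq => e; rewrite mem_partitions_upto => lee.
  rewrite -(sum_pieri_even lee) mulr_sumr; apply: eq_bigr => d _.
  by ring.
rewrite (big_interlaced t (G := fun p e =>
  (- b) ^+ (sumn c - sumn e) * p * (- a) ^+ alt_sum e)) //; last first.
  by move=> e; rewrite mulr0 mul0r.
rewrite -sum_interlaced_alt ?intpart_sorted //; apply: eq_big_seq => e eP.
have [_ _ _ srt] := interlacedP eP.
by rewrite sumn_mkpart alt_sum_mkpart // alt_powE.
Qed.

End EvenTheorem.

Theorem theorem4p1 (K : fieldType) (char0 : [pchar K] =i pred0)
    (t : K) (t_generic : forall r : nat, (0 < r)%N -> t ^+ r != 1)
    (a b : K) (a_neq0 : a != 0) (la : intpart) :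
  \sum_(mu \in [set mu : intpart | even_partition mu]%classic)
     hl_Q'skew t a b la mu
  = (- a) ^+ size (odd_parts la)
    * rs_h t (even_parts la) (a * b) * rs_h t (odd_parts la) (b / a).
Proof.
rewrite -(conjpK la); set c := conjp la.
have na0 : - a != 0 by rewrite oppr_eq0.
rewrite sum_hl_Q'skew_even // sum_hl_Q'skew_even_alt // rs_altE //.
rewrite size_odd_parts_conjp -alt_powE ?intpart_sorted // -mulrA; congr (_ * _).
rewrite /even_parts /odd_parts !rs_h_filter // -big_split; apply: eq_bigr => i _ /=.
case: (odd i) => /=.
  by rewrite mulr1 invrK mulrNN mulrC.
by rewrite mul1r invrN mulrNN.
Qed.
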